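(* Let $(M,\mathrm{dist})$ be a compact metric space, $f:M\to M$ a homeomorphism satisfying the periodic exponential specification property with exponent $\theta>0$, let $d\ge 1$, $\alpha>0$, and let $A:M\to M(d,\mathbb{R})$ be an $\alpha$-Hölder continuous map. Assume there exist $\rho,\tau>0$ with $\rho+\tau<\frac{\alpha\theta}{2}$ such that $$-\tau\le \gamma_1(A,\mu)+\gamma_2(A,\mu)+\cdots+\gamma_d(A,\mu)\le\rho$$ for every ergodic $f$-invariant Borel probability measure $\mu$ on $M$. Then $A(x)\in GL(d,\mathbb{R})$ for every $x\in M$.
   Context: $M(d,\mathbb{R})$ denotes the space of real $d\times d$ matrices, with the operator norm $\|\cdot\|$. $A$ is $\alpha$-Hölder continuous if there is $C_1>0$ with $\|A(x)-A(y)\|\le C_1\,\mathrm{dist}(x,y)^{\alpha}$ for all $x,y\in M$. Cocycle: $A^n(x)=A(f^{n-1}(x))\cdots A(f(x))A(x)$ for $n>0$ and $A^0(x)=\mathrm{Id}$. The matrices $A(x)$ are not assumed invertible. Lyapunov exponents: for an ergodic $f$-invariant Borel probability measure $\mu$, it is known (semi-invertible multiplicative ergodic theorem of Froyland, Lloyd and Quas) that for $\mu$-almost every $x$ there are numbers $\lambda_1>\cdots>\lambda_l\ge-\infty$ (independent of $x$) and a direct sum decomposition $\mathbb{R}^d=E^1_x\oplus\cdots\oplus E^l_x$, depending measurably on $x$, with $\dim E^i_x$ constant, $A(x)E^i_x\subseteq E^i_{f(x)}$ (with equality when $\lambda_i>-\infty$), and $\lambda_i=\lim_{n\to+\infty}\frac1n\log\|A^n(x)v\|$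 for every nonzero $v\in E^i_x$ (with $\log 0=-\infty$). $\gamma_1(A,\mu)\ge\gamma_2(A,\mu)\ge\cdots\ge\gamma_d(A,\mu)$ denote the numbers $\lambda_i$ listed with multiplicity $\dim E^i_x$; the value $-\infty$ is allowed (a sum with a term $-\infty$ equals $-\infty$). Periodic exponential specification property with exponent $\theta>0$: for every $\delta>0$ there exists a positive integer $S=S(\delta)$ such that for every $x\in M$ and every $n\in\mathbb{N}$ there exists a point $p\in M$ with $f^{n+S}(p)=p$ and $$\mathrm{dist}(f^j(p),f^j(x))<\delta e^{-\theta\min\{j,\,n-j\}}\quad\text{for all } j=0,1,\ldots,n.$$ *)

(* Defs.v *)
From HB Require Import structures.
From mathcomp Require Import all_boot all_order all_algebra.
From mathcomp Require Import all_classical all_reals all_analysis.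

Set Implicit Arguments.
Unset Strict Implicit.
Unset Printing Implicit Defensive.

Import Order.TTheory GRing.Theory Num.Theory.
Import numFieldNormedType.Exports.

Local Open Scope classical_set_scope.
Local Open Scope ring_scope.

(* Measurable types are pointed in the library, so a metric space carrying
   Borel measures has to be pointed, i.e. nonempty. *)
#[short(type="pointedMetricType")]
HB.structure Definition PointedMetric (R : numDomainType) :=
  { M of Metric R M & isPointed M }.

Notation borel M := (g_sigma_algebraType (@open M)).

Section LinearAlgebra.
Context {R : realType} {d : nat}.
Implicit Types (v : 'cV[R]_d) (B : 'M[R]_d) (E F : {vspace 'cV[R]_d}).

(* The library norm `|v| on matrices is the max norm. *)
Definition enorm v : R := Num.sqrt (\sum_i v i ord0 ^+ 2).

Definition opnorm B : R :=
  sup [set enorm (B *m v) | v in [set v | enorm v <= 1]].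

Definition vdist v F : R := inf [set enorm (v - w) | w in [set w | w \in F]].

(* The gap metric: it induces the usual topology on each Grassmannian, and
   subspaces of different dimensions are at distance 1. *)
Definition gap E F : R :=
  Num.max (sup [set vdist v F | v in [set v | v \in E /\ enorm v <= 1]])
          (sup [set vdist w E | w in [set w | w \in F /\ enorm w <= 1]]).

Definition grassmann_open (U : set {vspace 'cV[R]_d}) :=
  forall E, U E -> exists2 e : R, 0 < e & forall F, gap E F < e -> U F.

End LinearAlgebra.

Section Dynamics.
Context {R : realType} {M : pointedMetricType R}.
Implicit Types (f : M -> M) (mu : probability (borel M) R).

Definition homeomorphism f :=
  continuous f /\
  exists g : M -> M, [/\ continuous g, cancel f g & cancel g f].

(* N is read as the positive integers; this makes the property (hence any
   hypothesis using it) weaker than if n = 0 were included. *)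
Definition periodic_exp_specification f (theta : R) :=
  forall delta : R, 0 < delta ->
  exists2 S : nat, (0 < S)%N &
  forall (x : M) (n : nat), (0 < n)%N ->
  exists2 p : M, iter (n + S) f p = p &
  forall j : nat, (j <= n)%N ->
    mdist (iter j f p) (iter j f x)
      < delta * expR (- theta * (minn j (n - j))%:R).

Definition invariant_measure f mu :=
  forall B : set (borel M), measurable B -> mu (f @^-1` B) = mu B.

Definition ergodic_measure f mu :=
  invariant_measure f mu /\
  forall B : set (borel M), measurable B -> f @^-1` B = B ->
    mu B = 0%E \/ mu B = 1%E.

Section Cocycle.
Context {d : nat}.
Implicit Types (A : M -> 'M[R]_d).

Definition holder_matrix A (alpha : R) :=
  exists2 C1 : R, 0 < C1 &
  forall x y : M, opnorm (A x - A y) <= C1 * mdist x y `^ alpha.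

Fixpoint cocycle f A (n : nat) (x : M) : 'M[R]_d :=
  if n is k.+1 then A (iter k f x) *m cocycle f A k x else 1%:M.

Definition measurable_field (E : M -> {vspace 'cV[R]_d}) :=
  forall U, grassmann_open U -> measurable (E @^-1` U : set (borel M)).

(* lambda is the Lyapunov exponent of v at x; note lne 0 = -oo *)
Definition has_exponent f A (x : M) (v : 'cV[R]_d) (lambda : \bar R) :=
  (fun n : nat => (n%:R^-1)%:E * lne (enorm (cocycle f A n x *m v))%:E)%E
    @ \oo --> lambda.

(* Data of the semi-invertible Oseledets splitting: exponents lambda_i in
   [-oo, +oo), multiplicities m_i, and subspaces E^i_x. *)
Definition oseledets_splitting f A mu (l : nat) (lambda : 'I_l -> \bar R)
    (m : 'I_l -> nat) (E : 'I_l -> M -> {vspace 'cV[R]_d}) :=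
  [/\ forall i, (lambda i < +oo)%E /\ (0 < m i)%N,
      forall i j : 'I_l, (i < j)%N -> (lambda j < lambda i)%E,
      forall i, measurable_field (E i)
    & \forall x \ae mu,
      [/\ directv (\sum_i E i x)%VS /\ (\sum_i E i x = fullv)%VS,
          forall i, \dim (E i x) = m i,
          forall i, (linfun (mulmx (A x)) @: E i x <= E i (f x))%VS,
          forall i, lambda i != -oo%E ->
            (linfun (mulmx (A x)) @: E i x = E i (f x))%VS
        & forall i v, v \in E i x -> v != 0 ->
            has_exponent f A x v (lambda i)]].

(* gamma lists gamma_1 >= ... >= gamma_d: each lambda_i repeated m_i times *)
Definition lyapunov_exponents f A mu (gamma : d.-tuple (\bar R)) :=
  exists l (lambda : 'I_l -> \bar R) m E,
    oseledets_splitting f A mu lambda m E /\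
    tval gamma = flatten [seq nseq (m i) (lambda i) | i <- enum 'I_l].

End Cocycle.
End Dynamics.

(* Main.v *)
Require Import Defs.
From HB Require Import structures.
From mathcomp Require Import all_boot all_order all_algebra.
From mathcomp Require Import all_classical all_reals all_analysis.
From mathcomp Require Import measurable_realfun perm complex ring lra.

Set Implicit Arguments.
Unset Strict Implicit.
Unset Printing Implicit Defensive.

Import Order.TTheory GRing.Theory Num.Theory.
Import numFieldNormedType.Exports.

Local Open Scope classical_set_scope.
Local Open Scope ring_scope.

(* Idea. The sum of the Lyapunov exponents of mu is the growth rate of
   |det A^n|, so the hypothesis says that g = log |det A| has asymptotic
   average in [-tau, rho] for every ergodic measure. If det A vanishes at x0,
   specification gives periodic points of period 2k + S passing at distance
   e^(-theta k) from x0; there g is at most -alpha theta k + O(1), and as the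
   whole orbit has average at least -tau, the rest of the orbit has average at
   least alpha theta / 2 - tau > rho up to o(1). Truncating g from below by -L
   changes little, so every truncation has an invariant functional whose value
   is at least some b > rho.
   An ergodic measure with this property for all L at once is obtained without
   weak compactness: the invariant functionals are those dominated by a
   sublinear functional, Zorn's lemma gives an extreme one inside the face of
   maximizers, and extremality is ergodicity through the Riesz representation.
   Since |det A^n| grows at rate at most rho almost everywhere for that measure,
   integrating contradicts b > rho. *)

(** * Extreme functionals dominated by a sublinear functional *)

(** The hypothesis bounds exponents, not integrals of log |det A|. From above the passage is soft: a
    determinant is at most d! times the product of bounds on its columns, so an adapted basis
    controls |det A^n| almost everywhere. From below it would require control of the angles between
    Oseledets subspaces. The lower bound is needed on periodic orbits only. There the exponents are
    finite because of -tau, the return matrix T is invertible, and the soft upper bound for the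
    powers of T^-1 is a lower bound for |det T|; what remains is linear algebra: if all nonzero
    vectors of an invariant subspace grow under T, then T^-1 cannot grow much on it. No ergodic
    theorem is used for the limit measure: each Birkhoff average has the same integral as the
    function itself, and a bound that holds eventually almost everywhere passes to integrals by
    continuity of the measure along increasing sets. The truncation level may therefore grow with n,
    which is how the value -oo of log |det A| is handled. *)

Section Faces.
Context {R : realType} {V : lmodType R}.
Implicit Types (p q L : V -> R).

(** Homogeneity is stated as one inequality; scaling back by t^-1 gives the other. *)
Definition sublinear q :=
  (forall x y, q (x + y) <= q x + q y) /\
  (forall t x, 0 < t -> q (t *: x) <= t * q x).

(* Sublinear functionals stand for the convex sets of linear functionals that
   they dominate; this is the face relation between those sets. *)
Definition face p q :=
  forall L1 L2 t, scalar L1 -> scalar L2 ->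
    (forall x, L1 x <= p x) -> (forall x, L2 x <= p x) -> 0 < t < 1 ->
    (forall x, t * L1 x + (1 - t) * L2 x <= q x) ->
  forall x, L1 x <= q x.

Lemma scalar_D L : scalar L -> forall x y, L (x + y) = L x + L y.
Proof. by move=> h x y; have := h 1 x y; rewrite scale1r mul1r. Qed.

Lemma scalar_0 L : scalar L -> L 0 = 0.
Proof. by move=> h; have := scalar_D h 0 0; rewrite addr0; lra. Qed.

Lemma scalar_Z L : scalar L -> forall t x, L (t *: x) = t * L x.
Proof.
by move=> h t x; have := h t x 0; rewrite !addr0 (scalar_0 h) addr0.
Qed.

Lemma scalar_N L : scalar L -> forall x, L (- x) = - L x.
Proof. by move=> h x; rewrite -scaleN1r (scalar_Z h) mulN1r. Qed.

Lemma scalar_B L : scalar L -> forall x y, L (x - y) = L x - L y.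
Proof. by move=> h x y; rewrite (scalar_D h) (scalar_N h). Qed.

Lemma sublinear_0 q : sublinear q -> q 0 = 0.
Proof.
move=> [_ h]; have := h 2 0 ltac:(lra); have := h (2^-1) 0 ltac:(lra).
rewrite !scaler0; lra.
Qed.

Lemma sublinear_Z q t x : sublinear q -> 0 <= t -> q (t *: x) = t * q x.
Proof.
move=> sq; rewrite le_eqVlt => /orP[/eqP<-|t0].
  by rewrite scale0r mul0r sublinear_0.
apply/eqP; rewrite eq_le (proj2 sq)//= -ler_pdivlMl//.
have := proj2 sq t^-1 (t *: x); rewrite invr_gt0 => /(_ t0).
by rewrite scalerA mulVf ?scale1r// gt_eqF.
Qed.

Lemma sublinear_N q x : sublinear q -> - q (- x) <= q x.
Proof.
move=> sq; have := proj1 sq x (- x); rewrite subrr sublinear_0//; lra.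
Qed.

(* With beta := inf_n q (phi n), q' is the support functional of the face of
   functionals dominated by q whose values on all the phi n are at least beta. *)
Lemma sublinear_face_step p q (phi : nat -> V) (b : R) :
  sublinear q -> (forall x, q x <= p x) -> face p q ->
  (forall m n, (m <= n)%N -> q (phi n - phi m) <= 0) ->
  (forall n, b <= q (phi n)) ->
  exists q', [/\ sublinear q', face p q', forall x, q' x <= q x &
    forall n, q' (- phi n) <= - b].
Proof.
move=> sq qp fq dec bq.
pose beta := inf (range (q \o phi)).
have lbE : has_lbound (range (q \o phi)) by exists b => _ [n _ <-] /=.
have beta_le n : beta <= q (phi n) by apply: ge_inf => //; exists n.
have b_beta : b <= beta.
  by apply: lb_le_inf; [exists (q (phi 0%N)), 0%N|move=> _ [n _ <-] /=].
(* [q] sees [phi] as decreasing, so an index may be raised; two indices can then be replaced by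
   their maximum. *)
have dec' m n t x : (m <= n)%N -> 0 <= t ->
    q (t *: phi n + x) <= q (t *: phi m + x).
  move=> mn t0; have -> : t *: phi n + x = t *: (phi n - phi m) + (t *: phi m + x).
    by rewrite scalerBr addrA subrK.
  apply: le_trans (proj1 sq _ _) _; rewrite sublinear_Z//.
  have := dec _ _ mn; nra.
(* The infimum of this set is the largest sublinear functional below [q] that is at most -beta at
   every -phi n: subadditivity at x = (t phi n + x) + t (-phi n) forces each of these bounds. *)
pose E x := [set q (s.1 *: phi s.2 + x) - s.1 * beta | s in
   [set s : R * nat | 0 <= s.1]].
have ElbP x : lbound (E x) (- q (- x)).
  move=> _ [[t n] /= t0 <-].
  have := proj1 sq (t *: phi n + x) (- x); rewrite addrK sublinear_Z//.
  have := beta_le n; nra.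
have Elb x : has_lbound (E x) by eexists; exact: ElbP.
have E0 x : E x !=set0 by exists (q (0 *: phi 0%N + x) - 0 * beta), (0, 0%N) => /=.
pose q' x := inf (E x).
have q'_ge x c : lbound (E x) c -> c <= q' x by move=> ?; apply: lb_le_inf.
have q'_le x t n : 0 <= t -> q' x <= q (t *: phi n + x) - t * beta.
  by move=> t0; apply: ge_inf => //; exists (t, n).
have q'q x : q' x <= q x.
  by have := @q'_le x 0 0%N (lexx _); rewrite scale0r add0r mul0r subr0.
have q'phi n : q' (- phi n) <= - beta.
  have := @q'_le (- phi n) 1 n ler01.
  by rewrite scale1r subrr sublinear_0// mul1r sub0r.
exists q'; split => //.
- split.
  + move=> x y; rewrite -lerBlDr; apply: (q'_ge) => _ [[t n] /= t0 <-].
    rewrite lerBlDr -lerBlDl; apply: (q'_ge) => _ [[s m] /= s0 <-].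
    have st0 : 0 <= s + t by lra.
    have := @q'_le (x + y) (s + t) (maxn m n) st0.
    have := dec' _ _ _ x (leq_maxr m n) t0.
    have := dec' _ _ _ y (leq_maxl m n) s0.
    have := proj1 sq (s *: phi (maxn m n) + y) (t *: phi (maxn m n) + x).
    rewrite addrACA -scalerDl (addrC y x); lra.
  + move=> s x s0; rewrite -ler_pdivrMl//; apply: (q'_ge) => _ [[t n] /= t0 <-].
    rewrite ler_pdivrMl//; apply: le_trans (@q'_le _ (s * t) n _) _.
      by rewrite mulr_ge0// ltW.
    by rewrite -scalerA -scalerDr (sublinear_Z _ sq (ltW s0)) mulrBr mulrA.
- move=> L1 L2 t l1 l2 L1p L2p t01 mean x.
  have meanq y : t * L1 y + (1 - t) * L2 y <= q y by apply: le_trans (q'q _).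
  have L1q := fq _ _ _ l1 l2 L1p L2p t01 meanq.
  have L2q : forall y, L2 y <= q y.
    apply: (fq L2 L1 (1 - t)) => //; first by lra.
    by move=> y; rewrite subKr addrC.
  (* At phi k the mean of [L1] and [L2] is at least beta, while [L2] is at most [q], which is nearly
     beta there; so [L1] cannot fall short. The tolerance e * t leaves an error of at most e after
     division by t. *)
  have L1phi n : beta <= L1 (phi n).
    apply/ler_addgt0Pr => e e0.
    have et : 0 < e * t by rewrite mulr_gt0//; lra.
    have [|_ [m _ <-] /= hm] := inf_adherent et (E := range (q \o phi)).
      by split => //; exists (q (phi 0%N)), 0%N.
    pose k := maxn m n.
    have h1 : q (phi k) <= q (phi m).
      by have := dec' m k 1 0 (leq_maxl _ _) ler01; rewrite !scale1r !addr0.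
    have h2 : L1 (phi k) <= L1 (phi n).
      have := le_trans (L1q (phi k - phi n)) (dec _ _ (leq_maxr _ _)).
      by rewrite (scalar_B l1); lra.
    have h3 := L2q (phi k).
    have h4 : t * L1 (phi k) + (1 - t) * L2 (phi k) >= beta.
      have := le_trans (mean (- phi k)) (q'phi k).
      by rewrite (scalar_N l1) (scalar_N l2); lra.
    rewrite -/beta in hm.
    have /andP[t0 t1] := t01.
    have h5 : L2 (phi k) <= beta + e * t by lra.
    have h6 : t * (beta - e) <= t * L1 (phi k).
      have : (1 - t) * L2 (phi k) <= (1 - t) * (beta + e * t).
        by rewrite ler_pM2l//; lra.
      nra.
    rewrite ler_pM2l// in h6; lra.
  apply: (q'_ge) => _ [[s n] /= s0 <-].
  have := L1q (s *: phi n + x); rewrite (scalar_D l1) (scalar_Z l1).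
  have := L1phi n; nra.
- by move=> n; apply: le_trans (q'phi n) _; rewrite lerN2.
Qed.

(** Zorn's lemma on the sublinear functionals that define faces plays the role of Krein-Milman. A
    minimal one is linear, since otherwise the face step at a single vector would shrink it; and a
    face defined by a linear functional is a single extreme point. *)
Lemma exists_extreme_scalar p (phi : nat -> V) (b : R) :
  sublinear p ->
  (forall m n, (m <= n)%N -> p (phi n - phi m) <= 0) ->
  (forall n, b <= p (phi n)) ->
  exists L, [/\ scalar L, forall x, L x <= p x, forall n, b <= L (phi n) &
    forall L1 L2 t, scalar L1 -> scalar L2 ->
    (forall x, L1 x <= p x) -> (forall x, L2 x <= p x) -> 0 < t < 1 ->
    (forall x, t * L1 x + (1 - t) * L2 x = L x) -> L1 =1 L].
Proof.
move=> sp dec bp.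
have fp : face p p by [].
have [q0 [sq0 fq0 q0p q0b]] := sublinear_face_step sp (fun=> lexx _) fp dec bp.
pose good q := [/\ sublinear q, face p q & forall x, q x <= q0 x].
have good0 : good q0 by [].
pose T := {q | good q}.
(* The order is reversed: maximal for [le] means pointwise minimal. *)
pose le (q r : T) : bool := `[< forall x, sval r x <= sval q x >].
have [||A Atot|[q [sq fq qq0]] qmax] := @ZL_preorder T (exist _ q0 good0) le.
- by move=> t; apply/asboolP.
- move=> r s t /asboolP rs /asboolP st; apply/asboolP => x.
  exact: le_trans (st x) (rs x).
(* A chain is bounded by its pointwise infimum; for subadditivity, the smaller of two members of the
   chain serves both arguments. *)
- have [[a Aa]|A0] := pselect (A !=set0); last first.
    by exists (exist _ q0 good0) => s As; case: A0; exists s.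
  pose E x := [set sval q x | q in A].
  have ElbP x : lbound (E x) (- p (- x)).
    move=> _ [[r [sr fr rq0]] _ <-] /=.
    apply: le_trans (sublinear_N _ sr); rewrite lerN2.
    exact: le_trans (rq0 _) (q0p _).
  have Elb x : has_lbound (E x) by eexists; exact: ElbP.
  have E0 x : E x !=set0 by exists (sval a x), a.
  pose q x := inf (E x).
  have qge x c : lbound (E x) c -> c <= q x by move=> ?; apply: lb_le_inf.
  have qle x r : A r -> q x <= sval r x by move=> Ar; apply: ge_inf => //; exists r.
  have gq : good q.
    split.
    + split.
        move=> x y; rewrite -lerBlDr; apply: (qge) => _ [r Ar <-].
        rewrite lerBlDr -lerBlDl; apply: (qge) => _ [s As <-].
        have [/asboolP sr|/asboolP rs] := Atot _ _ Ar As.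
        - have := proj1 (let: And3 h _ _ := svalP s in h) x y.
          by have := qle (x + y) _ As; have := sr x; lra.
        - have := proj1 (let: And3 h _ _ := svalP r in h) x y.
          by have := qle (x + y) _ Ar; have := rs y; lra.
      move=> t x t0; rewrite -ler_pdivrMl//; apply: (qge) => _ [r Ar <-].
      rewrite ler_pdivrMl//; apply: le_trans (qle _ _ Ar) _.
      exact: (proj2 (let: And3 h _ _ := svalP r in h)).
    + move=> L1 L2 t l1 l2 L1p L2p t01 mean x.
      apply: (qge) => _ [r Ar <-].
      have [_ fr _] := svalP r.
      by apply: (fr L1 L2 t) => // y; exact: le_trans (mean y) (qle _ _ Ar).
    + by move=> x; apply: le_trans (qle _ _ Aa) _; have [_ _] := svalP a; apply.
  exists (exist _ q gq) => s As; apply/asboolP => x /=; exact: qle.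
have qp x : q x <= p x by exact: le_trans (qq0 x) (q0p x).
(* The constant sequence x cuts out the functionals with the maximal value q x at x. By minimality
   the cut changes nothing, so q (-x) <= -q x. *)
have qN x : q (- x) = - q x.
  have [||q' [sq' fq' q'q q'x]] :=
    sublinear_face_step (phi := fun=> x) (b := q x) sq qp fq.
  - by move=> m n _; rewrite subrr sublinear_0 ?lexx.
  - by move=> n; exact: lexx.
  have gq' : good q' by split=> // y; exact: le_trans (q'q y) (qq0 y).
  have /asboolP /= := qmax (exist _ q' gq') ltac:(by apply/asboolP).
  move=> /(_ (- x)) h; apply/eqP; rewrite eq_le (le_trans h (q'x 0%N))/=.
  by rewrite lerNl sublinear_N.
have lq : scalar q.
  have qD x y : q (x + y) = q x + q y.
    apply/eqP; rewrite eq_le (proj1 sq)/=.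
    have := proj1 sq (- x) (- y); rewrite -opprD !qN; lra.
  move=> t x y; rewrite qD; congr (_ + _).
  have [t0|t0] := leP 0 t; first by rewrite sublinear_Z.
  rewrite -[t]opprK scaleNr qN sublinear_Z//; last by lra.
  by rewrite -mulNr.
exists q; split => //.
  by move=> n; have := le_trans (qq0 (- phi n)) (q0b n); rewrite qN; lra.
move=> L1 L2 t l1 l2 L1p L2p t01 mean x.
have L1q := fq _ _ _ l1 l2 L1p L2p t01 (fun y => ltac:(by rewrite mean)).
apply/eqP; rewrite eq_le L1q/=.
by have := L1q (- x); rewrite qN (scalar_N l1) lerN2.
Qed.

End Faces.

(** * Riesz representation on a compact metric space *)

Section CompactMetric.
Context {R : realType} {M : pointedMetricType R}.
Implicit Types (phi psi : M -> R) (U : set M).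

Lemma continuous_cst (c : R) : continuous (fun _ : M => c).
Proof. by move=> x; exact: cvg_cst. Qed.

Lemma continuous_add phi psi :
  continuous phi -> continuous psi -> continuous (fun x => phi x + psi x).
Proof. by move=> h k x; apply: cvgD; [exact: h|exact: k]. Qed.

Lemma continuous_scale c phi : continuous phi -> continuous (fun x => c * phi x).
Proof. by move=> h x; apply: cvgMr; exact: h. Qed.

Lemma continuous_opp phi : continuous phi -> continuous (fun x => - phi x).
Proof. by move=> h x; apply: cvgN; exact: h. Qed.

Lemma continuous_sub phi psi :
  continuous phi -> continuous psi -> continuous (fun x => phi x - psi x).
Proof. by move=> h k; apply: continuous_add => //; exact: continuous_opp. Qed.

Lemma continuous_sum (h : nat -> M -> R) n :
  (forall i, continuous (h i)) -> continuous (fun x => \sum_(i < n) h i x).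
Proof.
move=> ch; elim: n => [|n ih].
  by under eq_fun do rewrite big_ord0; exact: continuous_cst.
by under eq_fun do rewrite big_ord_recr /=; exact: continuous_add.
Qed.

Lemma continuous_maxf phi psi : continuous phi -> continuous psi ->
  continuous (fun x => Num.max (phi x) (psi x)).
Proof.
by move=> h k x; apply: (@continuous_max _ _ phi psi); [exact: h|exact: k].
Qed.

Lemma continuous_minf phi psi : continuous phi -> continuous psi ->
  continuous (fun x => Num.min (phi x) (psi x)).
Proof.
by move=> h k x; apply: (@continuous_min _ _ phi psi); [exact: h|exact: k].
Qed.

Lemma open_lt_continuous c phi : continuous phi -> open [set x | c < phi x].
Proof.
move=> h; have -> : [set x | c < phi x] = phi @^-1` [set y | c < y] by [].
by move/continuousP: h; apply; exact: open_gt.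
Qed.

Lemma compact_continuous_bounded phi : compact [set: M] -> continuous phi ->
  exists2 K, 0 < K & forall x, `|phi x| <= K.
Proof.
move=> cM h.
have : compact (range phi).
  by apply: continuous_compact => //; apply: continuous_subspaceT.
move=> /compact_bounded[K [_ /(_ (`|K| + 1))]]; rewrite ltr_pwDr ?ler_norm//.
move=> /(_ isT) b; exists (`|K| + 1); first by rewrite ltr_wpDl.
by move=> x; apply: b; exists x.
Qed.

(** The open sets where [h n] exceeds [phi] increase with n and cover M, so by compactness one of
    them is all of M. *)
Lemma dini_lt phi (h : nat -> M -> R) : compact [set: M] ->
  continuous phi -> (forall n, continuous (h n)) ->
  (forall m n x, (m <= n)%N -> h m x <= h n x) ->
  (forall x, exists n, phi x < h n x) ->
  exists n, forall x, phi x < h n x.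
Proof.
rewrite compact_cover => cM cphi ch hmono hx.
have [|x _|D _ DU] := cM _ setT (fun n => [set x | 0 < h n x - phi x]).
- by move=> n _; apply: open_lt_continuous; exact: continuous_sub.
- by have [n hn] := hx x; exists n => //=; rewrite subr_gt0.
exists (\max_(i <- finmap.enum_fset D) i)%N => x; have [n /= nD] := DU x I.
rewrite subr_gt0 => /lt_le_trans; apply; apply: hmono.
by apply: (@leq_bigmax_seq _ _ xpredT id n).
Qed.

(** This is min(1, m dist(x, M - U)); having 1 in the set makes the infimum correct also when the
    complement of [U] is empty. *)
Definition cutoff U (m : nat) (x : M) : R :=
  inf ([set 1] `|` [set m%:R * mdist x y | y in ~` U]).

Let cutoff_lb U m x : lbound ([set 1] `|` [set m%:R * mdist x y | y in ~` U]) 0.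
Proof. by move=> _ [->//|[y _ <-]]; rewrite mulr_ge0// mdist_ge0. Qed.

Let cutoff_n0 U m x :
  ([set 1 : R] `|` [set m%:R * mdist x y | y in ~` U]) !=set0.
Proof. by exists 1; left. Qed.

Lemma cutoff_ge0 U m x : 0 <= cutoff U m x.
Proof. by apply: lb_le_inf => //; exact: cutoff_lb. Qed.

Lemma cutoff_le U m x y : ~ U y -> cutoff U m x <= m%:R * mdist x y.
Proof.
by move=> Uy; apply: ge_inf; [exists 0; exact: cutoff_lb|right; exists y].
Qed.

Lemma cutoff_le1 U m x : cutoff U m x <= 1.
Proof. by apply: ge_inf; [exists 0; exact: cutoff_lb|left]. Qed.

Lemma cutoff_le_indic U m x : cutoff U m x <= \1_U x.
Proof.
rewrite indicE; have [Ux|Ux] := boolP (x \in U); first exact: cutoff_le1.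
move: Ux; rewrite notin_setE => /(@cutoff_le U m x).
by rewrite mdistxx mulr0.
Qed.

Lemma cutoff_mono U m n x : (m <= n)%N -> cutoff U m x <= cutoff U n x.
Proof.
move=> mn; apply: lb_le_inf => // _ [->|[y Uy <-]]; first exact: cutoff_le1.
apply: le_trans (cutoff_le _ _ Uy) _.
by rewrite ler_wpM2r ?mdist_ge0// ler_nat.
Qed.

Lemma cutoff_eq1 U x : open U -> U x -> exists m, cutoff U m x = 1.
Proof.
move=> oU Ux; have /nbhs_ballP[r /= r0] : nbhs x U by exact: open_nbhs_nbhs.
rewrite ballEmdist => rU.
have [m mr] : exists m, r^-1 < m%:R.
  by exists (Num.bound r^-1); apply: archi_boundP; rewrite invr_ge0 ltW.
exists m; apply/eqP; rewrite eq_le cutoff_le1/=.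
apply: lb_le_inf => // _ [->//|[y Uy <-]].
have ry : r <= mdist x y by rewrite leNgt; apply/negP => /rU.
rewrite -[leLHS](mulVf (lt0r_neq0 r0)); by apply: ler_pM; rewrite ?invr_ge0//; apply: ltW.
Qed.

Lemma cutoff_continuous U m : continuous (cutoff U m).
Proof.
have lip x x' : cutoff U m x <= cutoff U m x' + m%:R * mdist x x'.
  rewrite -lerBlDr; apply: lb_le_inf => // _ [->|[y Uy <-]].
    rewrite lerBlDr; apply: le_trans (cutoff_le1 _ _ _) _.
    by rewrite lerDl mulr_ge0// mdist_ge0.
  rewrite lerBlDr; apply: le_trans (cutoff_le _ _ Uy) _.
  by rewrite -mulrDr ler_wpM2l// addrC metric_triangle.
move=> x; apply/(@pseudometric_normed_Zmodule.cvgrPdist_lt _ R^o) => e e0.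
(* The Lipschitz constant m may be 0, hence the division by m + 1. *)
have m0 : (0 : R) < m%:R + 1 by rewrite ltr_wpDl.
have e1 : 0 < e / (m%:R + 1) by rewrite divr_gt0.
near=> y.
have xy : mdist x y < e / (m%:R + 1).
  by near: y; apply/nbhs_ballP; exists (e / (m%:R + 1)) => //; rewrite ballEmdist.
have h : m%:R * mdist x y < e.
  apply: le_lt_trans (_ : _ <= (m%:R + 1) * mdist x y) _.
    by rewrite ler_wpM2r ?mdist_ge0// lerDl.
  by rewrite mulrC -ltr_pdivlMr.
have := lip x y; have := lip y x; rewrite (metric_sym y x) => h1 h2.
by rewrite ltr_norml; apply/andP; split; lra.
Unshelve. all: by end_near. Qed.

End CompactMetric.

(** The functional takes all functions as arguments but is constrained on the continuous ones only;
    its other values are arbitrary. *)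
Definition positive_functional {R : realType} {M : pointedMetricType R}
    (L : (M -> R) -> R) :=
  [/\ forall phi psi : M -> R, continuous phi -> continuous psi ->
        L (fun x => phi x + psi x) = L phi + L psi,
      forall (c : R) (phi : M -> R), continuous phi -> L (fun x => c * phi x) = c * L phi,
      forall phi : M -> R, continuous phi -> (forall x, 0 <= phi x) -> 0 <= L phi &
      L (fun=> 1) = 1].

Section PositiveFunctional.
Context {R : realType} {M : pointedMetricType R}.
Variable (L : (M -> R) -> R).
Hypothesis posL : positive_functional L.
Implicit Types (phi psi : M -> R) (U : set M).

Lemma functional_add phi psi : continuous phi -> continuous psi ->
  L (fun x => phi x + psi x) = L phi + L psi.
Proof. by have [h _ _ _] := posL; exact: h. Qed.

Lemma functional_scale c phi : continuous phi ->
  L (fun x => c * phi x) = c * L phi.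
Proof. by have [_ h _ _] := posL; exact: h. Qed.

Lemma functional_cst c : L (fun=> c) = c.
Proof.
have [_ _ _ h1] := posL.
have := functional_scale c (@continuous_cst _ M 1); by rewrite h1 !mulr1.
Qed.

Lemma functional_sub phi psi : continuous phi -> continuous psi ->
  L (fun x => phi x - psi x) = L phi - L psi.
Proof.
move=> cphi cpsi; rewrite -mulN1r -functional_scale// -functional_add//.
  by congr L; apply/funext => x; rewrite mulN1r.
exact: continuous_scale.
Qed.

Lemma functional_le phi psi : continuous phi -> continuous psi ->
  (forall x, phi x <= psi x) -> L phi <= L psi.
Proof.
move=> cphi cpsi h; rewrite -subr_ge0 -functional_sub//.
have [_ _ p _] := posL; apply: p; first exact: continuous_sub.
by move=> x; rewrite subr_ge0.
Qed.

Lemma functional_sum (h : nat -> M -> R) n : (forall i, continuous (h i)) ->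
  L (fun x => \sum_(i < n) h i x) = \sum_(i < n) L (h i).
Proof.
move=> ch; elim: n => [|n ih].
  rewrite big_ord0 -[RHS](functional_cst 0); congr L.
  by apply/funext => x; rewrite big_ord0.
rewrite big_ord_recr /= -ih -functional_add//; last exact: continuous_sum.
by congr L; apply/funext => x; rewrite big_ord_recr.
Qed.

(** The Riesz mass of an open set. Test functions may be negative; this leaves the supremum
    unchanged, since the positive part of a test function is again one. *)
Definition open_mass U : R :=
  sup [set L phi | phi in [set phi : M -> R | continuous phi /\ forall x, phi x <= \1_U x]].

Lemma open_mass_ge U phi : continuous phi -> (forall x, phi x <= \1_U x) ->
  L phi <= open_mass U.
Proof.
move=> cphi h; apply: ub_le_sup; last by exists phi.
exists 1 => _ [psi [cpsi hpsi] <-]; rewrite -[leRHS](functional_cst 1).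
apply: functional_le => //; first exact: continuous_cst.
by move=> x; apply: le_trans (hpsi x) _; rewrite indicE lern1 leq_b1.
Qed.

Lemma open_mass_le U c :
  (forall phi : M -> R, continuous phi -> (forall x, phi x <= \1_U x) -> L phi <= c) ->
  open_mass U <= c.
Proof.
move=> h; apply: ge_sup; last by move=> _ [phi [cphi hphi] <-]; exact: h.
by exists (L (fun=> 0)), (fun=> 0) => //; split;
  [exact: continuous_cst|move=> x; rewrite indicE].
Qed.

Lemma open_mass_mono U U' : U `<=` U' -> open_mass U <= open_mass U'.
Proof.
move=> UU'; apply: open_mass_le => phi cphi h; apply: open_mass_ge => // x.
apply: le_trans (h x) _; rewrite !indicE ler_nat.
by case: (boolP (x \in U)) => [/set_mem/UU'/mem_set ->|_].
Qed.

Lemma open_mass_ge0 U : 0 <= open_mass U.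
Proof.
rewrite -[leLHS](functional_cst 0); apply: open_mass_ge.
  exact: continuous_cst.
by move=> x; rewrite indicE.
Qed.

Lemma open_mass_setT : open_mass setT = 1.
Proof.
apply/eqP; rewrite eq_le; apply/andP; split.
  apply: open_mass_le => phi cphi h; rewrite -[leRHS](functional_cst 1).
  apply: functional_le => //; first exact: continuous_cst.
  by move=> x; have := h x; rewrite indicT.
rewrite -[leLHS](functional_cst 1); apply: open_mass_ge.
  exact: continuous_cst.
by move=> x; rewrite indicT.
Qed.

Lemma open_mass_set0 : open_mass set0 = 0.
Proof.
apply/eqP; rewrite eq_le open_mass_ge0 andbT.
apply: open_mass_le => phi cphi h; rewrite -[leRHS](functional_cst 0).
apply: functional_le => //; first exact: continuous_cst.
by move=> x; have := h x; rewrite indic0.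
Qed.

Definition functional_outer (X : set M) : \bar R :=
  ereal_inf [set (open_mass U)%:E | U in [set U | open U /\ X `<=` U]].

Lemma functional_outer_open U : open U -> functional_outer U = (open_mass U)%:E.
Proof.
move=> oU; apply/eqP; rewrite eq_le; apply/andP; split.
  by apply: ereal_inf_lbound; exists U => //; split => //; exact: subset_refl.
apply: le_ereal_inf_tmp => _ [U' [oU' UU'] <-].
by rewrite lee_fin open_mass_mono.
Qed.

Lemma functional_outer_ge0 X : (0 <= functional_outer X)%E.
Proof.
by apply: le_ereal_inf_tmp => _ [U _ <-]; rewrite lee_fin open_mass_ge0.
Qed.

Lemma functional_outer_le1 X : (functional_outer X <= 1)%E.
Proof.
apply: ereal_inf_lbound; exists setT; last by rewrite open_mass_setT.
by split; [exact: openT|exact: subsetT].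
Qed.

Lemma functional_outer_fin X : functional_outer X \is a fin_num.
Proof.
rewrite ge0_fin_numE ?functional_outer_ge0//.
exact: le_lt_trans (functional_outer_le1 X) (ltry 1).
Qed.

Lemma functional_outer_mono : {homo functional_outer : X Y / X `<=` Y >-> (X <= Y)%E}.
Proof.
move=> X Y XY; apply: le_ereal_inf_tmp => _ [U [oU YU] <-].
by apply: ereal_inf_lbound; exists U => //; split => //; exact: subset_trans YU.
Qed.

Lemma functional_outer_adherent X e : 0 < e ->
  exists U, [/\ open U, X `<=` U & ((open_mass U)%:E < functional_outer X + e%:E)%E].
Proof.
move=> e0; have [_ [U [oU XU] <-] h] :=
  lb_ereal_inf_adherent e0 (functional_outer_fin X).
by exists U.
Qed.

Hypothesis cM : compact [set: M].

(** For a nearly optimal test function phi of the union, phi - e/2 is pointwise below some finite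
    sum of cutoffs: some cutoff reaches 1 on the union, and phi <= 0 outside it. Compactness makes
    the number of terms uniform. *)
Lemma open_mass_sigma (U : nat -> set M) e : (forall n, open (U n)) -> 0 < e ->
  exists n, open_mass (\bigcup_n U n) <= \sum_(i < n) open_mass (U i) + e.
Proof.
move=> oU e0.
have [phi [cphi hphi] phie] : exists2 phi : M -> R, continuous phi /\
    (forall x, phi x <= \1_(\bigcup_n U n) x) &
    open_mass (\bigcup_n U n) <= L phi + e / 2.
  apply: contrapT => h.
  have : open_mass (\bigcup_n U n) <= open_mass (\bigcup_n U n) - e / 2.
    apply: open_mass_le => phi cphi hphi; rewrite leNgt; apply/negP => lt.
    by apply: h; exists phi => //; lra.
  lra.
(* The index is both the number of sets and the slope of the cutoffs, which gives one increasing
   sequence. *)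
pose h n x := \sum_(i < n) cutoff (U i) n x.
have ch n : continuous (h n).
  by apply: (continuous_sum (h := fun i => cutoff (U i) n)) => i; exact: cutoff_continuous.
have hge0 n x : 0 <= h n x by apply: sumr_ge0 => i _; exact: cutoff_ge0.
have hmono m n x : (m <= n)%N -> h m x <= h n x.
  move=> mn; rewrite /h -(subnKC mn) big_split_ord /= -[leLHS]addr0.
  apply: lerD; last by apply: sumr_ge0 => i _; exact: cutoff_ge0.
  by apply: ler_sum => i _; rewrite subnKC//; exact: cutoff_mono.
have [||n hn] := @dini_lt _ _ (fun x => phi x - e / 2) h cM _ ch hmono.
- by apply: continuous_sub => //; exact: continuous_cst.
- move=> x; have [[i _ Uix]|nU] := pselect ((\bigcup_n U n) x); last first.
    exists 0%N; have := hphi x; rewrite indicE memNset//=.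
    by have := hge0 0%N x; lra.
  have [m m1] := cutoff_eq1 (oU i) Uix.
  exists (maxn m i.+1).
  have -> : h (maxn m i.+1) x = cutoff (U i) (maxn m i.+1) x +
      \sum_(j < maxn m i.+1 | j != Ordinal (leq_maxr m i.+1)) cutoff (U j) (maxn m i.+1) x.
    by rewrite /h (bigD1 (Ordinal (leq_maxr m i.+1))).
  have := cutoff_mono (U i) x (leq_maxl m i.+1).
  have : 0 <= \sum_(j < maxn m i.+1 | j != Ordinal (leq_maxr m i.+1)) cutoff (U j) (maxn m i.+1) x.
    by apply: sumr_ge0 => j _; exact: cutoff_ge0.
  have := hphi x; rewrite indicE mem_set/=; last by exists i.
  rewrite m1; lra.
exists n.
have : L (fun x => phi x - e / 2) <= L (h n).
  apply: functional_le => //.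
    by apply: continuous_sub => //; exact: continuous_cst.
  by move=> x; exact: ltW.
rewrite functional_sub//; last exact: continuous_cst.
rewrite functional_cst (functional_sum (h := fun i => cutoff (U i) n)); last first.
  by move=> i; exact: cutoff_continuous.
have : \sum_(i < n) L (cutoff (U i) n) <= \sum_(i < n) open_mass (U i).
  apply: ler_sum => i _; apply: open_mass_ge; first exact: cutoff_continuous.
  by move=> x; exact: cutoff_le_indic.
lra.
Qed.

Lemma functional_outer_sigma_subadditive : sigma_subadditive functional_outer.
Proof.
move=> F; apply/lee_addgt0Pr => e e0.
have e2 : 0 < e / 2 by lra.
have eps n : 0 < e / 2 / (2 ^ n.+1)%:R by rewrite divr_gt0// ltr0n expn_gt0.
have [U hU] := choice (fun n => functional_outer_adherent (F n) (eps n)).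
have oU n : open (U n) by have [] := hU n.
have [n hn] := open_mass_sigma oU e2.
apply: le_trans (_ : (open_mass (\bigcup_n U n))%:E <= _)%E.
  rewrite -functional_outer_open; last exact: bigcup_open.
  apply: functional_outer_mono => x [i _ Fix]; exists i => //.
  by have [_ + _] := hU i; apply.
rewrite [e in X in (_ <= X)%E]splitr EFinD addeA.
apply: le_trans (_ : (\sum_(i < n) open_mass (U i) + e / 2)%:E <= _)%E.
  by rewrite lee_fin.
rewrite EFinD leeD2r//.
apply: le_trans (epsilon_trick (A := functional_outer \o F) xpredT
  (fun=> functional_outer_ge0 _) (ltW e2)).
apply: le_trans (nneseries_lim_ge n _); last first.
  by move=> k _ _; rewrite adde_ge0 ?functional_outer_ge0// lee_fin ltW.
rewrite big_mkord -sumEFin.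
by apply: lee_sum => i _; have [_ _ /ltW] := hU i.
Qed.

Lemma functional_outer_set0 : functional_outer set0 = 0%E.
Proof. by rewrite functional_outer_open ?open_mass_set0//; exact: open0. Qed.

HB.instance Definition _ := isOuterMeasure.Build R M functional_outer
  functional_outer_set0 functional_outer_ge0 functional_outer_mono
  functional_outer_sigma_subadditive.

(** W is the part of V where a nearly optimal test function phi of V [&] U is below e/2. There
    max(phi - e/2, 0) vanishes, so adding a test function of W to it gives a test function of V. *)
Lemma open_mass_split U V e : open U -> open V -> 0 < e ->
  exists W, [/\ open W, V `\` U `<=` W &
    open_mass (V `&` U) + open_mass W <= open_mass V + e].
Proof.
move=> oU oV e0.
have [phi [cphi hphi] phie] : exists2 phi : M -> R, continuous phi /\
    (forall x, phi x <= \1_(V `&` U) x) &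
    open_mass (V `&` U) <= L phi + e / 2.
  apply: contrapT => h.
  have : open_mass (V `&` U) <= open_mass (V `&` U) - e / 2.
    apply: open_mass_le => phi cphi hphi; rewrite leNgt; apply/negP => lt.
    by apply: h; exists phi => //; lra.
  lra.
pose W := V `&` [set x | - (e / 2) < - phi x].
have oW : open W.
  by apply: openI => //; apply: open_lt_continuous; exact: continuous_opp.
exists W; split => //.
  move=> x [Vx Ux]; split => //=.
  by have := hphi x; rewrite indicE memNset/=; [lra|case].
rewrite -lerBrDl; apply: open_mass_le => psi cpsi hpsi.
have c1 : continuous (fun x => phi x - e / 2).
  by apply: continuous_sub => //; exact: continuous_cst.
have c2 : continuous (fun x => Num.max (phi x - e / 2) 0).
  by apply: continuous_maxf => //; exact: continuous_cst.
have h1 : L phi - e / 2 <= L (fun x => Num.max (phi x - e / 2) 0).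
  rewrite -[X in _ - X]functional_cst -functional_sub//; last exact: continuous_cst.
  by apply: functional_le => // x; rewrite le_max lexx.
have h2 : L (fun x => Num.max (phi x - e / 2) 0 + psi x) <= open_mass V.
  apply: open_mass_ge; first exact: continuous_add.
  move=> x; have := hphi x; have := hpsi x; rewrite !indicE.
  have [Vx|Vx] := pselect (V x); last first.
    rewrite !memNset//; [|by case..] => /=.
    by move=> p1 p2; rewrite max_r; lra.
  rewrite (mem_set Vx).
  have [Wx|Wx] := pselect (W x).
    rewrite (mem_set Wx) /=; case: Wx => _ /= p0 p1 p2.
    by rewrite max_r; lra.
  rewrite (memNset Wx) /= => p1 p2.
  have p3 : phi x <= 1 by apply: le_trans p2 _; rewrite lern1 leq_b1.
  by case: (leP (phi x - e / 2) 0); lra.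
rewrite functional_add// in h2; lra.
Qed.

Lemma open_caratheodory U : open U -> functional_outer.-caratheodory U.
Proof.
move=> oU; apply: le_caratheodory_measurable => X.
apply/lee_addgt0Pr => e e0; have e2 : 0 < e / 2 by lra.
have [V [oV XV Ve]] := functional_outer_adherent X e2.
have [W [oW VUW hW]] := open_mass_split oU oV e2.
apply: le_trans (_ : (open_mass (V `&` U))%:E + (open_mass W)%:E <= _)%E.
  rewrite -!functional_outer_open//; last exact: openI.
  apply: leeD; apply: functional_outer_mono; first exact: setSI.
  by apply: subset_trans VUW; exact: setSI.
rewrite -EFinD; apply: le_trans (_ : (open_mass V + e / 2)%:E <= _)%E.
  by rewrite lee_fin.
by rewrite [e in X in (_ <= X)%E]splitr !EFinD addeA leeD2r// ltW.
Qed.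

Lemma borel_caratheodory (X : set (borel M)) :
  measurable X -> functional_outer.-cara.-measurable X.
Proof.
apply: smallest_sub => [|U oU]; last exact: open_caratheodory.
split; first exact: measurable0.
- by move=> A mA; rewrite setTD; exact: measurableC.
- by move=> A mA; exact: bigcup_measurable.
Qed.

Definition functional_measure : set (borel M) -> \bar R := functional_outer.

Let functional_measure_sigma_additive : semi_sigma_additive functional_measure.
Proof.
move=> F mF tF mUF; apply: (@caratheodory_measure_sigma_additive R M) => //.
  by move=> i; exact: borel_caratheodory.
exact: borel_caratheodory.
Qed.

HB.instance Definition _ := isMeasure.Build _ _ _ functional_measure
  functional_outer_set0 functional_outer_ge0 functional_measure_sigma_additive.

Let functional_measure_setT : functional_measure setT = 1%E.
Proof.
by rewrite /functional_measure functional_outer_open ?open_mass_setT//; exact: openT.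
Qed.

HB.instance Definition _ := Measure_isProbability.Build _ _ _ functional_measure
  functional_measure_setT.

Definition functional_probability : probability (borel M) R := functional_measure.

End PositiveFunctional.

(** * Integrals of continuous functions against Borel probabilities *)

Section BorelIntegral.
Context {R : realType} {M : pointedMetricType R}.
Hypothesis cM : compact [set: M].
Variable mu : probability (borel M) R.
Implicit Types (phi : M -> R) (B U : set M).

Lemma open_borel U : open U -> measurable (U : set (borel M)).
Proof. by move=> oU; exact: sub_sigma_algebra. Qed.

Lemma continuous_borel phi : continuous phi ->
  measurable_fun setT (phi : borel M -> R).
Proof.
move=> /continuousP cphi; apply: (measurability _ (RGenOpens.measurableE R)).
move=> _ [_ [a [b ->] <-]]; rewrite setTI; apply: open_borel.
by apply: cphi; exact: interval_open.
Qed.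

Lemma continuous_integrable phi (D : set (borel M)) : measurable D ->
  continuous phi -> mu.-integrable D (EFin \o (phi : borel M -> R)).
Proof.
move=> mD cphi; apply: (@integrableS _ _ _ _ setT) => //.
apply: measurable_bounded_integrable => //.
- by rewrite (@le_lt_trans _ _ 1%E) ?ltry// probability_le1.
- exact: continuous_borel.
- have [K K0 hK] := compact_continuous_bounded cM cphi.
  by exists K; split; [exact: num_real|move=> y Ky x _; apply: le_trans (hK x) (ltW Ky)].
Qed.

(** For an invariant set and its complement, these conditional averages are the two functionals
    between which a nonergodic measure is a proper mean. *)
Lemma Rintegral_positive (D : set (borel M)) : measurable D -> mu D != 0%E ->
  positive_functional
    (fun phi => (fine (mu D))^-1 * \int[mu]_(x in D) (phi x)).
Proof.
move=> mD D0.
have fD : 0 < fine (mu D).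
  by rewrite fine_gt0// lt0e D0 measure_ge0/= (le_lt_trans (probability_le1 _ _)) ?ltry.
split.
- move=> phi psi cphi cpsi; rewrite -mulrDr RintegralD//;
  exact: continuous_integrable.
- move=> c phi cphi; rewrite RintegralZl//; last exact: continuous_integrable.
  by rewrite mulrCA.
- move=> phi cphi h; rewrite mulr_ge0 ?invr_ge0 ?(ltW fD)//.
  by apply: Rintegral_ge0 => x _.
- by rewrite Rintegral_cst// mul1r mulVf// gt_eqF.
Qed.

Lemma Rintegral_setT_positive : positive_functional (fun phi => \int[mu]_x (phi x)).
Proof.
have := @Rintegral_positive setT measurableT.
rewrite probability_setT /= invr1 => /(_ (oner_neq0 _)).
by under [X in positive_functional X]eq_fun do rewrite mul1r.
Qed.

Lemma Rintegral_indicT (U : set (borel M)) : measurable U ->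
  \int[mu]_x (\1_U x) = fine (mu U).
Proof. by move=> mU; rewrite /Rintegral integral_indic// setIT. Qed.

Lemma indic_integrable (U : set (borel M)) : measurable U ->
  mu.-integrable setT (EFin \o (\1_U : borel M -> R)).
Proof.
move=> mU; apply: measurable_bounded_integrable => //.
  by rewrite (@le_lt_trans _ _ 1%E) ?ltry// probability_le1.
exists 1; split; [exact: num_real|move=> y y1 x _]; rewrite /= indicE.
by case: (_ \in _); rewrite ?normr1 ?normr0 ltW// (lt_trans _ y1).
Qed.

Lemma Rintegral_le_measure phi (U : set (borel M)) : measurable U ->
  continuous phi -> (forall x, phi x <= \1_U x) -> \int[mu]_x (phi x) <= fine (mu U).
Proof.
move=> mU cphi h; rewrite -Rintegral_indicT//; apply: le_Rintegral => //.
  exact: continuous_integrable.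
exact: indic_integrable.
Qed.

Lemma measure_le_Rintegral phi (U : set (borel M)) : measurable U ->
  continuous phi -> (forall x, \1_U x <= phi x) -> fine (mu U) <= \int[mu]_x (phi x).
Proof.
move=> mU cphi h; rewrite -Rintegral_indicT//; apply: le_Rintegral => //.
  exact: indic_integrable.
exact: continuous_integrable.
Qed.

End BorelIntegral.

Section LayerCake.
Context {R : realType} {M : pointedMetricType R}.
Implicit Types (phi : M -> R).

(** The slice of [phi] between heights k and k + 1. It lies between the indicators of two
    consecutive superlevel sets, which are open for continuous [phi]. *)
Definition layer phi (k : nat) : M -> R :=
  fun x => Num.max 0 (Num.min 1 (phi x - k%:R)).

Lemma layer_continuous phi k : continuous phi -> continuous (layer phi k).
Proof.
move=> cphi; apply: continuous_maxf; first exact: continuous_cst.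
apply: continuous_minf; first exact: continuous_cst.
by apply: continuous_sub => //; exact: continuous_cst.
Qed.

Lemma layer_sum phi n x : 0 <= phi x <= n%:R ->
  \sum_(k < n) layer phi k x = phi x.
Proof.
move=> /andP[p0 pn].
suff -> : \sum_(k < n) layer phi k x = Num.min (phi x) n%:R by rewrite min_l.
elim: n {pn} => [|n ih]; first by rewrite big_ord0 min_r.
rewrite big_ord_recr /= ih /layer -natr1.
by case: (leP (phi x) n%:R) => h; case: (leP 1 (phi x - n%:R)) => h1;
  case: (leP 0 _) => h2; case: (leP (phi x) (n%:R + 1)) => h3; lra.
Qed.

Lemma layer_le_indic phi k x :
  layer phi k x <= \1_[set x | k%:R < phi x] x.
Proof.
rewrite /layer indicE; have [h|h] := ltP k%:R (phi x).
  by rewrite mem_set//= ge_max ler01 ge_min lexx.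
rewrite memNset/=; last by rewrite ltNge h.
by rewrite ge_max lexx ge_min subr_le0 h orbT.
Qed.

Lemma indic_le_layer phi k x :
  \1_[set x | k.+1%:R < phi x] x <= layer phi k x.
Proof.
rewrite /layer indicE -natr1; have [h|h] := ltP (k%:R + 1) (phi x).
  by rewrite mem_set//= le_max le_min lexx lerBrDl (ltW h) orbT.
by rewrite memNset/= ?le_max ?lexx// ltNge h.
Qed.

End LayerCake.

Lemma sum_le_shift {R : numDomainType} (a b : nat -> R) n :
  (forall k, a k.+1 <= b k) -> (forall k, a k <= 1) -> (forall k, 0 <= b k) ->
  \sum_(k < n) a k <= \sum_(k < n) b k + 1.
Proof.
move=> ab a1 b0; case: n => [|n]; first by rewrite !big_ord0 add0r ler01.
rewrite big_ord_recl big_ord_recr /= [leLHS]addrC -addrA; apply: lerD.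
  by apply: ler_sum => i _; exact: ab.
by apply: le_trans (a1 _) _; rewrite lerDr.
Qed.

(** It suffices that L is at most the integral, by passing to -phi. Slicing compares L of slice k +
    1 with the integral of slice k through the mass of the open superlevel set between them. The
    regularity clauses are what later transfers invariance and extremality from L to the measure. *)
Theorem riesz_markov {R : realType} {M : pointedMetricType R}
    (L : (M -> R) -> R) : compact [set: M] -> positive_functional L ->
  exists mu : probability (borel M) R,
  [/\ forall phi : M -> R, continuous phi -> \int[mu]_x (phi x) = L phi,
      forall (X : set (borel M)) e, 0 < e -> exists U : set M,
        [/\ open U, X `<=` U & (mu U <= mu X + e%:E)%E] &
      forall (U : set M) e, open U -> 0 < e -> exists phi : M -> R,
        [/\ continuous phi, forall x, phi x <= \1_U x & fine (mu U) <= L phi + e]].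
Proof.
move=> cM posL; pose mu := functional_probability posL cM.
have muE U : open U -> mu U = (open_mass L U)%:E.
  by move=> oU; exact: functional_outer_open.
pose I := fun phi : M -> R => \int[mu]_x (phi x).
have posI : positive_functional I := Rintegral_setT_positive cM mu.
have Lle01 (phi : M -> R) : continuous phi -> (forall x, 0 <= phi x <= 1) -> L phi <= I phi.
  move=> cphi h01; apply/ler_addgt0Pr => e e0.
  have [n ne] : exists n, e^-1 < n%:R.
    by exists (Num.bound e^-1); apply: archi_boundP; rewrite invr_ge0 ltW.
  have n0 : (0 : R) < n%:R by apply: lt_trans ne; rewrite invr_gt0.
  have n0' : (0 < n)%N by rewrite -(ltr_nat R).
  (* Scaling by n before slicing turns the unit error of the index shift into 1/n. *)
  pose psi := fun x => n%:R * phi x.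
  have cpsi : continuous psi by exact: continuous_scale.
  have psiE : psi = fun x => \sum_(k < n) layer psi k x.
    apply/funext => x; rewrite layer_sum//; have /andP[h0 h1] := h01 x.
    by rewrite /psi mulr_ge0 ?ler0n//= -[leRHS]mulr1 ler_wpM2l.
  have Lpsi : L psi = \sum_(k < n) L (layer psi k).
    rewrite {1}psiE (functional_sum posL)// => i; exact: layer_continuous.
  have Ipsi : I psi = \sum_(k < n) I (layer psi k).
    rewrite {1}psiE (functional_sum posI)// => i; exact: layer_continuous.
  have LI k : L (layer psi k.+1) <= I (layer psi k).
    have oU : open [set x | k.+1%:R < psi x] by exact: open_lt_continuous.
    apply: le_trans (_ : fine (mu [set x | k.+1%:R < psi x]) <= _).
      rewrite muE//=; apply: (open_mass_ge posL); first exact: layer_continuous.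
      by move=> x; exact: layer_le_indic.
    apply: measure_le_Rintegral => //; first exact: open_borel.
      exact: layer_continuous.
    by move=> x; exact: indic_le_layer.
  have L0 k : L (layer psi k) <= 1.
    rewrite -[leRHS](functional_cst posL 1); apply: (functional_le posL).
    - exact: layer_continuous.
    - exact: continuous_cst.
    - by move=> x; rewrite /layer ge_max ler01 ge_min lexx.
  have I0 k : 0 <= I (layer psi k).
    have [_ _ p _] := posI; apply: p; first exact: layer_continuous.
    by move=> x; rewrite le_max lexx.
  have : L psi <= I psi + 1.
    rewrite Lpsi Ipsi.
    exact: (sum_le_shift (a := fun k => L (layer psi k)) (b := fun k => I (layer psi k))).
  rewrite {1}/psi (functional_scale posL)// (functional_scale posI)//.
  move=> h; have : L phi <= I phi + n%:R^-1.
    by rewrite -(ler_pM2l n0) mulrDr divff ?gt_eqF.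
  move=> /le_trans; apply; rewrite lerD2l ltW// -[e]invrK ltf_pV2 ?posrE//.
  by rewrite invr_gt0.
have Lle (phi : M -> R) : continuous phi -> L phi <= I phi.
  move=> cphi; have [K K0 hK] := compact_continuous_bounded cM cphi.
  pose psi := fun x => (2 * K)^-1 * (phi x + K).
  have K2 : 0 < (2 * K)^-1 by rewrite invr_gt0; lra.
  have c1 : continuous (fun x => phi x + K).
    by apply: continuous_add => //; exact: continuous_cst.
  have cpsi : continuous psi by exact: continuous_scale.
  have := Lle01 psi cpsi; rewrite /psi (functional_scale posL)// (functional_scale posI)//.
  rewrite (functional_add posL) ?(functional_add posI)//; [|exact: continuous_cst..].
  rewrite (functional_cst posL) (functional_cst posI) ler_pM2l// lerD2r; apply.
  move=> x; have := hK x; rewrite ler_norml => /andP[h1 h2].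
  rewrite /psi mulr_ge0 ?(ltW K2)//=; last lra.
  by rewrite ler_pdivrMl; lra.
exists mu; split.
- move=> phi cphi; apply/eqP; rewrite eq_le (Lle phi cphi) andbT.
  have := Lle _ (continuous_opp cphi).
  have oppE : (fun x => - phi x) = (fun x => -1 * phi x).
    by apply/funext => x; rewrite mulN1r.
  rewrite oppE (functional_scale posL)// (functional_scale posI)//.
  by rewrite !mulN1r lerN2.
- move=> X e e0; have [U [oU XU h]] := functional_outer_adherent posL X e0.
  by exists U; split => //; rewrite muE//; exact: ltW.
- move=> U e oU e0; rewrite muE//=; apply: contrapT => h.
  have : open_mass L U <= open_mass L U - e.
    apply: open_mass_le => phi cphi hphi; rewrite leNgt; apply/negP => lt.
    by apply: h; exists phi; split => //; lra.
  lra.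
Qed.

(** * Existence of ergodic measures *)

Section ContinuousFunctions.
Context {R : realType} {M : pointedMetricType R}.

Definition cts : {pred M -> R} := fun phi => `[< continuous phi >].

Fact cts_submod_closed : submod_closed cts.
Proof.
split; first by rewrite unfold_in; apply/asboolP; exact: continuous_cst.
move=> a phi psi; rewrite !unfold_in => /asboolP cphi /asboolP cpsi.
apply/asboolP; apply: (@continuous_add _ _ (fun x => a * phi x) psi) => //.
exact: continuous_scale.
Qed.

HB.instance Definition _ :=
  GRing.isSubmodClosed.Build R (M -> R) cts cts_submod_closed.

Record ctsfun := CtsFun { ctsval :> M -> R; _ : ctsval \in cts }.

HB.instance Definition _ := [isSub for ctsval].
HB.instance Definition _ := [Choice of ctsfun by <:].
HB.instance Definition _ := [SubChoice_isSubLmodule of ctsfun by <:].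

Definition mkcts (phi : M -> R) (h : continuous phi) : ctsfun :=
  CtsFun (asboolT h : phi \in cts).

Lemma ctsfun_continuous (u : ctsfun) : continuous u.
Proof. by have := valP u; rewrite unfold_in => /asboolP. Qed.

Lemma ctsfun_eq (u v : ctsfun) : (forall x, u x = v x) -> u = v.
Proof. by move=> h; apply: val_inj; exact/funext. Qed.

(** Passes from the vector space of continuous functions, where the extreme point is found, to the
    setting of [positive_functional]; the value 0 elsewhere is arbitrary. *)
Definition ctsfun_ext (L : ctsfun -> R) (phi : M -> R) : R :=
  if pselect (continuous phi) is left h then L (mkcts h) else 0.

Lemma ctsfun_extE L (u : ctsfun) : ctsfun_ext L u = L u.
Proof.
rewrite /ctsfun_ext; case: pselect => [h|/(_ (@ctsfun_continuous u))//].
by congr L; exact: ctsfun_eq.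
Qed.

Lemma ctsfun_ext_mk L (phi : M -> R) (h : continuous phi) :
  ctsfun_ext L phi = L (mkcts h).
Proof. by rewrite -(ctsfun_extE L (mkcts h)). Qed.

End ContinuousFunctions.

(** * Invariant functionals and their support functional *)

Section Invariance.
Context {R : realType} {M : pointedMetricType R}.
Hypothesis cM : compact [set: M].
Variable f : M -> M.
Hypothesis cf : continuous f.

Definition invariant_functional (L : (M -> R) -> R) :=
  positive_functional L /\
  forall phi, continuous phi -> L (phi \o f) = L phi.

Lemma continuous_compf (phi : M -> R) : continuous phi -> continuous (phi \o f).
Proof. by move=> cphi x; apply: continuous_comp; [exact: cf|exact: cphi]. Qed.

Lemma continuous_self_measurable : measurable_fun setT (f : borel M -> borel M).
Proof.
apply: (@measurability _ _ (borel M) (borel M) setT f (@open M)) => // _ [U oU <-].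
rewrite setTI; apply: open_borel; by move/continuousP: cf; apply.
Qed.

Lemma Rintegral_invariant (mu : probability (borel M) R) (B : set (borel M))
    (phi : M -> R) : invariant_measure f mu -> measurable B -> f @^-1` B = B ->
  continuous phi -> \int[mu]_(x in B) (phi (f x)) = \int[mu]_(x in B) (phi x).
Proof.
move=> inv mB fB cphi; rewrite /Rintegral; congr fine.
have mf := continuous_self_measurable.
rewrite -[in LHS]fB.
rewrite -(integral_pushforward mf (f := EFin \o (phi : borel M -> R)))//.
- by apply: (eq_measure_integral mu) => A mA _; exact: inv.
- by apply/measurable_EFinP; exact: continuous_borel.
- by rewrite fB; apply: (continuous_integrable cM) => //; exact: continuous_compf.
Qed.

Definition invariant_sup (u : @ctsfun R M) : R :=
  sup [set L (ctsval u) | L in invariant_functional].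

Hypothesis ex_inv : exists L, invariant_functional L.

Let invariant_ub (u : @ctsfun R M) :
  has_sup [set L (ctsval u) | L in invariant_functional].
Proof.
split; first by have [L iL] := ex_inv; exists (L u), L.
have [K K0 hK] := compact_continuous_bounded cM (@ctsfun_continuous _ _ u).
exists K => _ [L [pL _] <-]; rewrite -[leRHS](functional_cst pL).
apply: (functional_le pL); [exact: ctsfun_continuous|exact: continuous_cst|].
by move=> x; exact: le_trans (ler_norm _) (hK x).
Qed.

Lemma invariant_sup_ge L u : invariant_functional L -> L (ctsval u) <= invariant_sup u.
Proof. by move=> iL; apply: ub_le_sup; [have [] := invariant_ub u|exists L]. Qed.

Lemma invariant_sup_le u c :
  (forall L, invariant_functional L -> L (ctsval u) <= c) -> invariant_sup u <= c.
Proof.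
by move=> h; apply: ge_sup; [have [] := invariant_ub u|move=> _ [L /h + <-]].
Qed.

Lemma invariant_sup_sublinear : sublinear invariant_sup.
Proof.
split.
- move=> u v; apply: invariant_sup_le => L iL; have [pL _] := iL.
  have -> : ctsval (u + v) = fun x => u x + v x by [].
  rewrite (functional_add pL); [|exact: ctsfun_continuous..].
  by apply: lerD; exact: invariant_sup_ge.
- move=> t u t0; apply: invariant_sup_le => L iL; have [pL _] := iL.
  have -> : ctsval (t *: u) = fun x => t * u x by [].
  rewrite (functional_scale pL); last exact: ctsfun_continuous.
  by rewrite ler_pM2l//; exact: invariant_sup_ge.
Qed.

(** Positivity, normalization and invariance are upper bounds on linear functionals: test on
    nonpositive functions, on the constants 1 and -1, and on u o f - u. Hence domination by the
    support functional recovers the whole convex set. *)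
Lemma le_invariant_sup (L : ctsfun -> R) : scalar L ->
  (forall u, L u <= invariant_sup u) -> invariant_functional (ctsfun_ext L).
Proof.
move=> sL Lp.
have Lneg (u : ctsfun) : (forall x, u x <= 0) -> L u <= 0.
  move=> u0; apply: le_trans (Lp u) _; apply: invariant_sup_le => l [pl _].
  rewrite -[leRHS](functional_cst pl); apply: (functional_le pl) => //.
    exact: ctsfun_continuous.
  exact: continuous_cst.
have L1 : L (mkcts (@continuous_cst _ _ 1)) = 1.
  have Lc c : L (mkcts (@continuous_cst _ _ c)) <= c.
    apply: le_trans (Lp _) _; apply: invariant_sup_le => l [pl _] /=.
    by rewrite (functional_cst pl).
  apply/eqP; rewrite eq_le Lc/=; have := Lc (-1).
  have -> : mkcts (@continuous_cst R M (-1)) = - mkcts (@continuous_cst _ _ 1).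
    exact: ctsfun_eq.
  by rewrite (scalar_N sL) lerN2.
have Linv (u : ctsfun) : L (mkcts (continuous_compf (@ctsfun_continuous _ _ u))) <= L u.
  rewrite -subr_le0 -(scalar_B sL); apply: le_trans (Lp _) _.
  apply: invariant_sup_le => l [pl il].
  have -> : ctsval (mkcts (continuous_compf (@ctsfun_continuous _ _ u)) - u)
    = fun x => (u \o f) x - u x by [].
  have cu := @ctsfun_continuous _ _ u.
  rewrite (functional_sub pl)//; last exact: continuous_compf.
  by rewrite il// subrr.
split; [split|].
- move=> phi psi cphi cpsi; rewrite !ctsfun_ext_mk//; first exact: continuous_add.
  move=> c; rewrite -(scalar_D sL); congr L; exact: ctsfun_eq.
- move=> c phi cphi; rewrite !ctsfun_ext_mk//; first exact: continuous_scale.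
  move=> h; rewrite -(scalar_Z sL); congr L; exact: ctsfun_eq.
- move=> phi cphi phi0; rewrite ctsfun_ext_mk// -oppr_le0 -(scalar_N sL).
  by apply: Lneg => x /=; rewrite oppr_le0.
- by rewrite (ctsfun_ext_mk L (@continuous_cst _ _ 1)) L1.
- move=> phi cphi.
  rewrite (ctsfun_ext_mk L cphi) (ctsfun_ext_mk L (continuous_compf cphi)).
  have E (u : ctsfun) : L (mkcts (continuous_compf (@ctsfun_continuous _ _ u))) = L u.
    apply/eqP; rewrite eq_le Linv/= -lerN2 -!(scalar_N sL).
    apply: le_trans (Linv _); rewrite le_eqVlt; apply/orP; left; apply/eqP.
    by congr L; exact: ctsfun_eq.
  by rewrite -[RHS]E; congr L; exact: ctsfun_eq.
Qed.

End Invariance.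

Section Ergodic.
Context {R : realType} {M : pointedMetricType R}.
Hypothesis cM : compact [set: M].
Variable f : M -> M.
Hypothesis hf : homeomorphism f.

Let cf : continuous f. Proof. by have [] := hf. Qed.

(** If phi is below the indicator of the preimage of an open U, then phi = (phi o g) o f with phi o
    g below the indicator of U; so mu (f^-1 U) <= mu U. Outer regularity extends this to Borel sets,
    and complements give equality. *)
Lemma invariant_functional_measure (L : (M -> R) -> R)
    (mu : probability (borel M) R) : invariant_functional f L ->
  (forall phi, continuous phi -> \int[mu]_x (phi x) = L phi) ->
  (forall (X : set (borel M)) e, 0 < e -> exists U : set M,
        [/\ open U, X `<=` U & (mu U <= mu X + e%:E)%E]) ->
  (forall (U : set M) e, open U -> 0 < e -> exists phi : M -> R,
        [/\ continuous phi, forall x, phi x <= \1_U x & fine (mu U) <= L phi + e]) ->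
  invariant_measure f mu.
Proof.
move=> [pL iL] muL outer inner.
have [_ [g [cg fg gf]]] := hf.
have mf (X : set (borel M)) : measurable X -> measurable (f @^-1` X : set (borel M)).
  by move=> mX; rewrite -[X in measurable X]setTI; exact: continuous_self_measurable.
have fin (X : set (borel M)) : measurable X -> mu X \is a fin_num.
  by move=> mX; rewrite ge0_fin_numE// (le_lt_trans (probability_le1 _ _)) ?ltry.
have openle U : open U -> (mu (f @^-1` U) <= mu U)%E.
  move=> oU; have ofU : open (f @^-1` U) by move/continuousP: cf; apply.
  have mU := open_borel oU; have mfU := open_borel ofU.
  rewrite -(fineK (fin _ mU)) -(fineK (fin _ mfU)) lee_fin.
  apply/ler_addgt0Pr => e e0; have [phi [cphi hphi h]] := inner _ _ ofU e0.
  apply: le_trans h _; rewrite lerD2r.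
  have cphig : continuous (phi \o g).
    by move=> x; apply: continuous_comp; [exact: cg|exact: cphi].
  have -> : phi = (phi \o g) \o f by apply/funext => x /=; rewrite fg.
  rewrite iL// -muL//; apply: Rintegral_le_measure => //= x.
  apply: le_trans (hphi _) _; rewrite !indicE.
  by have -> : (g x \in f @^-1` U) = (x \in U) by apply/idP/idP; rewrite !inE /= gf.
have le (X : set (borel M)) : measurable X -> (mu (f @^-1` X) <= mu X)%E.
  move=> mX; apply/lee_addgt0Pr => e e0; have [U [oU XU h]] := outer X e e0.
  apply: le_trans h; apply: le_trans (openle U oU).
  apply: le_measure; rewrite ?inE; [exact: mf| |by move=> x /XU].
  by apply: mf; exact: open_borel.
move=> B mB; apply/eqP; rewrite eq_le le//=.
have := le _ (measurableC mB); rewrite preimage_setC !probability_setC//; last exact: mf.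
rewrite -(fineK (fin _ mB)) -(fineK (fin _ (mf _ mB))) -!EFinB !lee_fin; lra.
Qed.

(** An invariant set B with measure strictly between 0 and 1 writes the extreme functional as a
    proper mean of the averages over B and its complement, so the average over the complement equals
    the functional. A continuous function close to the indicator of B contradicts this. *)
Theorem exists_ergodic_measure (g : nat -> M -> R) (b : R) :
  (forall n, continuous (g n)) ->
  (forall m n x, (m <= n)%N -> g n x <= g m x) ->
  (forall n, exists2 L, invariant_functional f L & b <= L (g n)) ->
  exists2 mu : probability (borel M) R, ergodic_measure f mu &
    forall n, b <= \int[mu]_x (g n x).
Proof.
move=> cg gmono gb.
have ex : exists L, invariant_functional f L by have [L] := gb 0%N; exists L.
pose phi n := mkcts (cg n).
have [|n|L [sL Lp Lb Lext]] := @exists_extreme_scalar _ _ (invariant_sup f) phi b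
   (invariant_sup_sublinear cM ex).
- move=> m n mn; apply: (invariant_sup_le cM ex) => l [pl _].
  rewrite -[leRHS](functional_cst pl); apply: (functional_le pl).
  + exact: ctsfun_continuous.
  + exact: continuous_cst.
  + by move=> x; rewrite /= subr_le0; exact: gmono.
- have [l il h] := gb n; apply: le_trans h _.
  exact: (invariant_sup_ge cM ex (phi n) il).
have iL := le_invariant_sup cM cf ex sL Lp.
have [pL Linv] := iL.
have [mu [muL outer inner]] := riesz_markov cM pL.
have inv := invariant_functional_measure iL muL outer inner.
exists mu; last first.
  by move=> n; rewrite muL// (ctsfun_ext_mk _ (cg n)); exact: Lb.
split => // B mB fB.
have [B0|B0] := eqVneq (mu B) 0%E; first by left.
have [C0|C0] := eqVneq (mu (~` B)) 0%E.
  right; have := probability_setC mu mB; rewrite C0 => /esym/eqP.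
  have fin : mu B \is a fin_num by rewrite ge0_fin_numE// (le_lt_trans (probability_le1 _ _)) ?ltry.
  by rewrite -(fineK fin) -EFinB eqe subr_eq0 => /eqP <-.
exfalso.
have mC := measurableC mB.
have fin (X : set (borel M)) : measurable X -> mu X \is a fin_num.
  by move=> mX; rewrite ge0_fin_numE// (le_lt_trans (probability_le1 _ _)) ?ltry.
have gt0 (X : set (borel M)) : measurable X -> mu X != 0%E -> 0 < fine (mu X).
  by move=> mX X0; rewrite fine_gt0// lt0e X0 measure_ge0/= -ge0_fin_numE// fin.
have bB := gt0 _ mB B0; have bC := gt0 _ mC C0.
have BC1 : fine (mu (~` B)) = 1 - fine (mu B).
  by rewrite probability_setC// fineB ?fin.
pose LX (X : set (borel M)) (u : @ctsfun R M) := (fine (mu X))^-1 * \int[mu]_(x in X) (u x).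
have LXs (X : set (borel M)) : measurable X -> mu X != 0%E -> scalar (LX X).
  move=> mX X0 a u v; have pX := Rintegral_positive cM mX X0.
  have cu := @ctsfun_continuous _ _ u; have cv := @ctsfun_continuous _ _ v.
  have := functional_add pX (continuous_scale (c := a) cu) cv.
  by rewrite (functional_scale pX a cu).
have LXp (X : set (borel M)) : measurable X -> mu X != 0%E -> f @^-1` X = X ->
    forall u, LX X u <= invariant_sup f u.
  move=> mX X0 fX u; apply: (invariant_sup_ge cM ex (L := fun phi => (fine (mu X))^-1 * \int[mu]_(x in X) (phi x))).
  split; first exact: Rintegral_positive.
  by move=> psi cpsi; congr (_ * _); exact: (Rintegral_invariant cM cf inv mX fX cpsi).
have fC : f @^-1` (~` B) = ~` B by rewrite -[in RHS]fB.
have mean (u : ctsfun) : fine (mu (~` B)) * LX (~` B) u + (1 - fine (mu (~` B))) * LX B u = L u.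
  rewrite BC1 subKr -BC1 /LX !mulrA !divff ?gt_eqF// !mul1r -ctsfun_extE -muL; last first.
    exact: ctsfun_continuous.
  rewrite -[in RHS](setvU B) Rintegral_setU//.
  - by apply: continuous_integrable => //; [exact: measurableU|exact: ctsfun_continuous].
  - by apply/eqP; rewrite setICl.
have t01 : 0 < fine (mu (~` B)) < 1 by rewrite bC/= BC1; lra.
have LCE := Lext _ _ _ (LXs _ mC C0) (LXs _ mB B0) (LXp _ mC C0 fC) (LXp _ mB B0 fB) t01 mean.
have e0 : 0 < fine (mu (~` B)) * fine (mu B) / 2 by rewrite divr_gt0// mulr_gt0.
have [U [oU BU hU]] := outer B _ e0.
have mU := open_borel oU.
have hU' : fine (mu U) <= fine (mu B) + fine (mu (~` B)) * fine (mu B) / 2.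
  by rewrite -lee_fin EFinD !fineK ?fin.
have [psi [cpsi hpsi hpsiU]] := inner U _ oU e0.
have UB : fine (mu B) <= fine (mu U).
  by rewrite -lee_fin !fineK ?fin//; apply: le_measure; rewrite ?inE.
have muUC : fine (mu (U `&` ~` B)) = fine (mu U) - fine (mu B).
  rewrite -setDE measureD//; last by rewrite -ge0_fin_numE ?fin.
  by rewrite (setIidr BU) fineB ?fin.
have : fine (mu (~` B)) * L (mkcts cpsi) <= fine (mu (U `&` ~` B)).
  rewrite -LCE /LX mulrA divff ?gt_eqF// mul1r /=.
  have -> : fine (mu (U `&` ~` B)) = \int[mu]_(x in ~` B) \1_U x.
    by rewrite /Rintegral integral_indic.
  apply: le_Rintegral => //; first exact: continuous_integrable.
  by apply: integrableS (indic_integrable mu mU).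
rewrite muUC -(ctsfun_ext_mk L cpsi).
have : fine (mu (~` B)) * (fine (mu B) - fine (mu (~` B)) * fine (mu B) / 2) <= fine (mu (~` B)) * ctsfun_ext L psi.
  rewrite ler_pM2l//; lra.
have : fine (mu (~` B)) * fine (mu B) * (1 - fine (mu (~` B))) > 0 by rewrite !mulr_gt0//; lra.
lra.
Qed.

End Ergodic.

(** * Determinants and Lyapunov exponents *)

Section DetBounds.
Context {R : realFieldType}.

(** A crude Hadamard inequality by columns; the factorial is harmless for exponential growth
    rates. *)
Lemma norm_det_le n (B : 'M[R]_n) (c : 'I_n -> R) :
  (forall i j, `|B i j| <= c j) -> `|\det B| <= n`!%:R * \prod_j c j.
Proof.
move=> Bc; rewrite /determinant; apply: le_trans (ler_norm_sum _ _ _) _.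
apply: le_trans (_ : _ <= \sum_(s : 'S_n) \prod_j c j) _; last first.
  by rewrite sumr_const card_Sn mulr_natl.
apply: ler_sum => s _.
rewrite normrM normrX normrN1 expr1n mul1r normr_prod.
rewrite [leRHS](reindex_inj (@perm_inj _ s)) /=.
by apply: ler_prod => i _; rewrite normr_ge0 Bc.
Qed.

Lemma norm_prodB_le n (a b : 'I_n -> R) K e : 1 <= K ->
  (forall i, `|a i| <= K) -> (forall i, `|b i| <= K) ->
  (forall i, `|a i - b i| <= e) ->
  `|\prod_i a i - \prod_i b i| <= n%:R * K ^+ n * e.
Proof.
move=> K1; have K0 : 0 <= K by lra.
elim: n a b => [|n ih] a b aK bK ab.
  by rewrite !big_ord0 subrr normr0 !mul0r.
rewrite !big_ord_recr /=.
set pa := \prod_(i < n) _; set pb := \prod_(i < n) b _.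
have e0 : 0 <= e := le_trans (normr_ge0 _) (ab ord_max).
have pbK : `|pb| <= K ^+ n.
  rewrite normr_prod; apply: le_trans (_ : _ <= \prod_(i < n) K) _.
    by apply: ler_prod => i _; rewrite normr_ge0 bK.
  by rewrite prodr_const card_ord.
have papb : `|pa - pb| <= n%:R * K ^+ n * e by exact: ih.
have -> : pa * a ord_max - pb * b ord_max =
  (pa - pb) * a ord_max + pb * (a ord_max - b ord_max) by ring.
apply: le_trans (ler_normD _ _) _; rewrite !normrM.
have h1 : `|pa - pb| * `|a ord_max| <= (n%:R * K ^+ n * e) * K.
  by apply: ler_pM => //; exact: aK.
have h2 : `|pb| * `|a ord_max - b ord_max| <= K ^+ n * e.
  by apply: ler_pM => //; exact: ab.
have h3 : K ^+ n * e <= K ^+ n * e * K.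
  by rewrite -[leLHS]mulr1 ler_wpM2l// mulr_ge0// exprn_ge0.
by apply: le_trans (lerD h1 (le_trans h2 h3)) _; rewrite -natr1 exprS; lra.
Qed.

Lemma norm_detB_le n (A B : 'M[R]_n) K e : 1 <= K ->
  (forall i j, `|A i j| <= K) -> (forall i j, `|B i j| <= K) ->
  (forall i j, `|A i j - B i j| <= e) ->
  `|\det A - \det B| <= n`!%:R * (n%:R * K ^+ n * e).
Proof.
move=> K1 AK BK AB; rewrite /determinant -sumrB.
apply: le_trans (ler_norm_sum _ _ _) _.
apply: le_trans (_ : _ <= \sum_(s : 'S_n) n%:R * K ^+ n * e) _; last first.
  by rewrite sumr_const card_Sn [leRHS]mulr_natl.
apply: ler_sum => s _.
by rewrite -mulrBr normrM normrX normrN1 expr1n mul1r; exact: norm_prodB_le.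
Qed.

End DetBounds.

Section EuclideanNorm.
Context {R : realType} {d : nat}.
Implicit Types (v w : 'cV[R]_d) (B : 'M[R]_d).

Lemma coord_le_enorm v i : `|v i ord0| <= enorm v.
Proof.
rewrite -sqrtr_sqr; apply: ler_wsqrtr; rewrite (bigD1 i)//= lerDl.
by apply: sumr_ge0 => j _; exact: sqr_ge0.
Qed.

Lemma enorm_le_sum v : enorm v <= \sum_i `|v i ord0|.
Proof.
have s0 : 0 <= \sum_i `|v i ord0| by apply: sumr_ge0.
rewrite -[leRHS]ger0_norm// -sqrtr_sqr; apply: ler_wsqrtr.
suff : forall s : seq 'I_d, \sum_(i <- s) v i ord0 ^+ 2 <= (\sum_(i <- s) `|v i ord0|) ^+ 2.
  by apply.
elim=> [|i s ih]; first by rewrite !big_nil expr0n.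
rewrite !big_cons; apply: le_trans (lerD (lexx _) ih) _.
have : 0 <= \sum_(j <- s) `|v j ord0| by apply: sumr_ge0.
have := normr_ge0 (v i ord0); rewrite -(real_normK (num_real (v i ord0))).
move: (`|_|) (\sum_(j <- s) _) => x y x0 y0; nra.
Qed.

Lemma enorm_mul_le B v : enorm (B *m v) <=
  (\sum_i \sum_j `|B i j|) * enorm v.
Proof.
apply: le_trans (enorm_le_sum _) _; rewrite mulr_suml; apply: ler_sum => i _.
rewrite mxE mulr_suml; apply: le_trans (ler_norm_sum _ _ _) _.
apply: ler_sum => j _; rewrite normrM ler_wpM2l//; exact: coord_le_enorm.
Qed.

Lemma entry_le_opnorm B i j : `|B i j| <= opnorm B.
Proof.
have e1 : enorm (delta_mx j ord0 : 'cV[R]_d) <= 1.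
  apply: le_trans (enorm_le_sum _) _; rewrite (bigD1 j)//= big1.
    by rewrite mxE !eqxx normr1 addr0.
  by move=> k kj; rewrite mxE (negbTE kj) normr0.
apply: le_trans (_ : _ <= enorm (B *m delta_mx j ord0)) _.
  have := coord_le_enorm (B *m delta_mx j ord0) i.
  by rewrite -colE mxE.
apply: ub_le_sup; last by exists (delta_mx j ord0).
exists (\sum_i \sum_j `|B i j|) => _ [v /= v1 <-].
apply: le_trans (enorm_mul_le _ _) _.
by rewrite -[leRHS]mulr1 ler_wpM2l// sumr_ge0// => k _; exact: sumr_ge0.
Qed.

End EuclideanNorm.

Section AdaptedBasis.
Context {R : realType} {d : nat}.

(** Concatenations with equal block sizes are aligned: position k falls into the same block of
    both. *)
Lemma flatten_nseq_nth (T S : Type) (I : eqType) (s : seq I) (X : I -> seq T)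
    (lam : I -> S) (m : I -> nat) x0 y0 k :
  (forall i, size (X i) = m i) -> (k < size (flatten [seq X i | i <- s]))%N ->
  exists i j, [/\ (j < size (X i))%N,
    nth x0 (flatten [seq X i | i <- s]) k = nth x0 (X i) j &
    nth y0 (flatten [seq nseq (m i) (lam i) | i <- s]) k = lam i].
Proof.
move=> sX; elim: s k => [//|i s ih] k /=.
rewrite size_cat !nth_cat size_nseq sX; case: (ltnP k (m i)) => km kl.
  by exists i, k; split; rewrite ?sX// nth_nseq km.
have [|i' [j' h]] := ih (k - m i)%N; first by rewrite ltn_subLR.
by exists i', j'.
Qed.

Lemma adapted_basis l (E : 'I_l -> {vspace 'cV[R]_d}) (m : 'I_l -> nat)
    (lam : 'I_l -> \bar R) (gamma : d.-tuple (\bar R)) :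
  directv (\sum_i E i) -> (\sum_i E i = fullv)%VS ->
  (forall i, \dim (E i) = m i) ->
  tval gamma = flatten [seq nseq (m i) (lam i) | i <- enum 'I_l] ->
  exists b : 'I_d -> 'cV[R]_d,
    (\matrix_(i, j) b j i ord0) \in unitmx /\
    forall k, exists i, [/\ b k \in E i, b k != 0 & tnth gamma k = lam i].
Proof.
move=> dE sE dimE gammaE.
pose X := flatten [seq (vbasis (E i) : seq _) | i <- enum 'I_l].
have XE : X = \big[cat/[::]]_(i < l) vbasis (E i).
  rewrite /X enumT [index_enum _]unlock.
  by elim: (Finite.enum _) => [|i s ih]; rewrite ?big_nil ?big_cons//= ih.
have bX : basis_of fullv X.
  by rewrite XE -sE; apply: bigcat_basis => // i _; exact: vbasisP.
have szX : size X = d.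
  by rewrite -(size_basis (X := in_tuple X) bX) dimvf /dim /= muln1.
have fX := basis_free bX.
have szm i : size (vbasis (E i)) = m i by rewrite size_tuple dimE.
exists (fun k : 'I_d => nth 0 X k); split.
  rewrite unitmxE unitfE -det_tr; apply/negP => /det0P[v v0 vX].
  have cX : \sum_(k < size X) v ord0 (cast_ord szX k) *: (in_tuple X)`_k = 0.
    rewrite (reindex (cast_ord (esym szX))) /=; last first.
      by exists (cast_ord szX) => k _; rewrite ?cast_ordK ?cast_ordKV.
    apply/matrixP => i j; rewrite summxE !mxE (ord1 j).
    have /matrixP/(_ ord0 i) := vX; rewrite !mxE; apply: etrans; apply: eq_bigr => k _.
    by rewrite cast_ordKV !mxE.
  have v0' := freeP (X := in_tuple X) fX _ cX.
  case/negP: v0; apply/eqP/matrixP => i j; rewrite (ord1 i) mxE.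
  by have := v0' (cast_ord (esym szX) j); rewrite cast_ordKV.
move=> k; have [|i [j [jl -> g]]] := @flatten_nseq_nth _ _ _ (enum 'I_l)
    (fun i => vbasis (E i) : seq _) lam m 0 0 k szm; first by rewrite -/X szX.
exists i; split.
- by apply: vbasis_mem; exact: mem_nth.
- by apply: (free_not0 (basis_free (vbasisP (E i)))); exact: mem_nth.
- by rewrite (tnth_nth 0) gammaE.
Qed.

End AdaptedBasis.

Section Exponents.
Context {R : realType} {M : pointedMetricType R} {d : nat}.
Variables (f : M -> M) (A : M -> 'M[R]_d).

Lemma has_exponent_bounds x v r e : has_exponent f A x v r%:E -> 0 < e ->
  \forall n \near \oo, expR (n%:R * (r - e)) <= enorm (cocycle f A n x *m v)
    <= expR (n%:R * (r + e)).
Proof.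
move=> /fine_cvgP[fin /cvgrPdist_lt cv] e0.
near=> n.
have n0 : (0 < n)%N by near: n; exists 1%N.
have n0' : (0 : R) < n%:R by rewrite ltr0n.
have : (((n%:R^-1)%:E * lne (enorm (cocycle f A n x *m v))%:E)%E : \bar R) \is a fin_num.
  by near: n.
have : `|r - fine ((n%:R^-1)%:E * lne (enorm (cocycle f A n x *m v))%:E)%E| < e.
  by near: n; exact: cv.
set y := enorm _.
(* A vanishing norm would make the quotient -oo, against finiteness of the limit. *)
have [y0|y0] := leP y 0.
  by rewrite /= y0 mulrNy gtr0_sg ?invr_gt0// mul1e.
rewrite lne_EFin// -EFinM /= ltr_norml => /andP[h1 h2] _.
have yE : y = expR (ln y) by rewrite lnK.
have : ln y = n%:R * (n%:R^-1 * ln y) by rewrite mulrA divff ?mul1r// gt_eqF.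
move: (n%:R^-1 * ln y) h1 h2 => t h1 h2 lnE.
rewrite yE !ler_expR lnE !ler_pM2l//; apply/andP; split; lra.
Unshelve. all: by end_near. Qed.

Lemma near_expR_ge (c e : R) : 0 < e -> \forall n \near \oo, c <= expR (n%:R * e).
Proof.
move=> e0; near=> n.
have : c / e <= n%:R by near: n; exact: nbhs_infty_ger.
rewrite ler_pdivrMr// => h; apply: le_trans h _.
have := expR_ge1Dx (n%:R * e); lra.
Unshelve. all: by end_near. Qed.

Lemma det_cocycle_upper x (b : 'I_d -> 'cV[R]_d) (c : 'I_d -> R) e :
  (\matrix_(i, j) b j i ord0) \in unitmx ->
  (forall k, has_exponent f A x (b k) (c k)%:E) -> 0 < e ->
  \forall n \near \oo,
    `|\det (cocycle f A n x)| <= expR (n%:R * (\sum_k c k + e)).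
Proof.
move=> Bu hb e0; set B := \matrix_(i, j) _ in Bu.
have B0 : 0 < `|\det B| by rewrite normr_gt0 -unitfE -unitmxE.
(* One share of e for each of the d columns, and one to absorb the constant d! / |det B|. *)
pose e' := e / (d.+1)%:R.
have e'0 : 0 < e' by rewrite divr_gt0// ltr0n.
have hall : \forall n \near \oo, forall k,
    enorm (cocycle f A n x *m b k) <= expR (n%:R * (c k + e')).
  apply: filter_forall => k.
  by apply: filterS (has_exponent_bounds (hb k) e'0) => n /andP[].
near=> n.
have h1 : forall k, enorm (cocycle f A n x *m b k) <= expR (n%:R * (c k + e')).
  by near: n.
have h2 : d`!%:R / `|\det B| <= expR (n%:R * e').
  by near: n; exact: near_expR_ge.
have h3 : `|\det (cocycle f A n x) * \det B| <=
    d`!%:R * \prod_k expR (n%:R * (c k + e')).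
  rewrite -det_mulmx; apply: norm_det_le => i j.
  apply: le_trans (h1 j); apply: le_trans (coord_le_enorm _ i).
  rewrite le_eqVlt; apply/orP; left; apply/eqP; congr `|_|.
  by rewrite !mxE; apply: eq_bigr => k _; rewrite mxE.
have h4 : \prod_k expR (n%:R * (c k + e')) = expR (n%:R * (\sum_k c k + d%:R * e')).
  rewrite -expR_sum -mulr_sumr big_split /= sumr_const card_ord.
  by rewrite [d%:R * _]mulr_natl.
rewrite normrM h4 -ler_pdivlMr// mulrAC in h3.
apply: le_trans h3 _; apply: le_trans (ler_wpM2r (expR_ge0 _) h2) _.
rewrite -expRD ler_expR -mulrDr ler_wpM2l//.
have : e = d.+1%:R * e' by rewrite /e' mulrC divfK// pnatr_eq0.
by rewrite -natr1; lra.
Unshelve. all: by end_near. Qed.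

End Exponents.

(** * Backward growth on Oseledets subspaces of periodic points *)

Section BackwardGrowth.
Context {F : numFieldType} {d : nat}.
Implicit Types (S T : 'M[F]_d) (u v w : 'cV[F]_d).

Definition shift_prod T u (l : seq F) :=
  foldl (fun w c => (T - c%:M) *m w) u l.

Lemma shift_mulC T c c' w :
  (T - c%:M) *m ((T - c'%:M) *m w) = (T - c'%:M) *m ((T - c%:M) *m w).
Proof.
rewrite !mulmxA; congr (_ *m _); rewrite !(mulmxBl, mulmxBr).
rewrite -!scalar_mxM [c' * c]mulrC !mul_scalar_mx !mul_mx_scalar.
by rewrite opprB addrACA [- _ + _]addrC -addrACA opprB; congr (_ + _); rewrite addrC.
Qed.

Lemma shift_prodC T c u l :
  shift_prod T ((T - c%:M) *m u) l = (T - c%:M) *m shift_prod T u l.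
Proof.
by elim: l u => //= c' l ih u; rewrite /shift_prod /= shift_mulC -/(shift_prod T _ l) ih.
Qed.

(** The factors commute, so one that is injective on [P] can be moved outermost and cancelled. *)
Lemma shift_prod_filter T (P : 'cV[F]_d -> Prop) (a : pred F) l v :
  (forall c w, P w -> P ((T - c%:M) *m w)) ->
  (forall c w, ~~ a c -> P w -> (T - c%:M) *m w = 0 -> w = 0) ->
  P v -> shift_prod T v l = 0 -> shift_prod T v [seq c <- l | a c] = 0.
Proof.
move=> Pst Pinj; elim: l v => //= c l ih v Pv lv.
have := ih _ (Pst c _ Pv) lv; case: ifPn => // ac h.
apply: Pinj ac _ _; last by rewrite -shift_prodC.
elim: [seq c <- l | a c] v Pv {ih lv h} => //= c' l' ih v Pv.
by apply: ih; exact: Pst.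
Qed.

(** Put w = (T - c) u. Then S^(n+1) u = c^-1 (S^n u - S^(n+1) w), where w is covered by induction;
    as |c|^-1 < s, the recursion preserves a bound of order s^n. *)
Lemma backward_growth S T l (s : F) u : S *m T = 1%:M -> 0 < s ->
  (forall c, c \in l -> c != 0 /\ `|c|^-1 < s) -> shift_prod T u l = 0 ->
  exists2 K, 0 <= K & forall n i, `|iter n (mulmx S) u i ord0| <= K * s ^+ n.
Proof.
move=> ST s0; elim: l u => [|c l ih] u hl /=.
  move=> ->; exists 0 => // n i.
  have -> : iter n (mulmx S) (0 : 'cV[F]_d) = 0 by elim: n => //= n ->; rewrite mulmx0.
  by rewrite mxE normr0 mul0r.
move=> lu; have [c0 cs] := hl c (mem_head _ _).
have [K K0 hK] := ih _ (fun c' h => hl c' (mem_behead (s := c :: l) h)) lu.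
pose q := `|c|^-1.
have q0 : 0 < q by rewrite invr_gt0 normr_gt0.
have sq : 0 < s - q by rewrite subr_gt0.
(* The second summand solves q (x + K s) = x s, the fixed point of the recursion; the first covers n
   = 0. *)
pose K' := \sum_i `|u i ord0| + q * K * s / (s - q).
have K'0 : 0 <= K'.
  rewrite addr_ge0 ?sumr_ge0// divr_ge0 ?(ltW sq)// mulr_ge0 ?(ltW s0)//.
  by rewrite mulr_ge0// ltW.
exists K' => // n i; elim: n => [|n ihn].
  rewrite expr0 mulr1 /K' (bigD1 i)//= -addrA lerDl addr_ge0 ?sumr_ge0//.
  by rewrite divr_ge0 ?(ltW sq)// mulr_ge0 ?(ltW s0)// mulr_ge0// ltW.
have iterB (x y : 'cV[F]_d) m : iter m (mulmx S) (x - y) = iter m (mulmx S) x - iter m (mulmx S) y.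
  by elim: m => //= m ->; rewrite mulmxBr.
have iterZ a (x : 'cV[F]_d) m : iter m (mulmx S) (a *: x) = a *: iter m (mulmx S) x.
  by elim: m => //= m ->; rewrite scalemxAr.
have rec : iter n.+1 (mulmx S) u =
    c^-1 *: (iter n (mulmx S) u - iter n.+1 (mulmx S) ((T - c%:M) *m u)).
  rewrite mulmxBl mul_scalar_mx iterB iterZ [in X in _ = X]iterSr.
  by rewrite mulmxA ST mul1mx opprB addrC subrK scalerA mulVf// scale1r.
rewrite rec mxE normrM normfV -/q.
apply: le_trans (_ : q * (K' * s ^+ n + K * s ^+ n.+1) <= _).
  rewrite ler_wpM2l ?(ltW q0)// mxE [X in `|_ + X|]mxE.
  by apply: le_trans (ler_normB _ _) _; apply: lerD => //; exact: hK.
rewrite [s ^+ n.+1]exprS !mulrA -mulrDl !mulrA ler_wpM2r ?exprn_ge0 ?(ltW s0)//.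
have : q * K * s <= (s - q) * K'.
  rewrite /K' mulrDr [X in _ <= _ + X]mulrC divfK ?gt_eqF// lerDr.
  by rewrite mulr_ge0 ?(ltW sq)// sumr_ge0.
have E : K' * s - q * (K' + K * s) = (s - q) * K' - q * K * s by ring.
by move=> h; rewrite -subr_ge0 E subr_ge0.
Qed.

End BackwardGrowth.

Section RealSpectrum.
Context {R : realType} {d : nat}.
Implicit Types (S T : 'M[R]_d) (u v w : 'cV[R]_d).
Local Open Scope complex_scope.
Local Notation C := R[i].
Local Notation toC := (map_mx (real_complex R)).
Local Notation reC := (map_mx (@complex.Re R)).
Local Notation imC := (map_mx (@complex.Im R)).

Lemma re_mulmx T (w : 'cV[C]_d) : reC (toC T *m w) = T *m reC w.
Proof.
apply/matrixP => i j; rewrite !mxE raddf_sum; apply: eq_bigr => k _.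
by rewrite !mxE; case: (w k j) => a b /=; rewrite mul0r subr0.
Qed.

Lemma im_mulmx T (w : 'cV[C]_d) : imC (toC T *m w) = T *m imC w.
Proof.
apply/matrixP => i j; rewrite !mxE raddf_sum; apply: eq_bigr => k _.
by rewrite !mxE; case: (w k j) => a b /=; rewrite mul0r addr0.
Qed.

Lemma annihilating_roots T : (0 < d)%N -> exists l : seq C,
  forall w : 'cV[C]_d, shift_prod (toC T) w l = 0.
Proof.
case: d T => // n T _.
have [l lE] := closed_field_poly_normal (char_poly (toC T)).
rewrite (monicP (char_poly_monic _)) scale1r in lE.
(* [foldl] applies the head of the list first, a matrix product its last factor. *)
exists (rev l) => w.
have := Cayley_Hamilton (toC T); rewrite lE rmorph_prod /= => h.
have -> : shift_prod (toC T) w (rev l) =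
    (\prod_(z <- l) horner_mx (toC T) ('X - z%:P)) *m w.
  rewrite /shift_prod foldl_rev {lE h}.
  elim: l => [|z l ih]; first by rewrite big_nil mul1mx.
  rewrite big_cons /= ih -mulmxE -mulmxA; congr (_ *m _).
  by rewrite rmorphB /= horner_mx_X horner_mx_C.
by rewrite h mul0mx.
Qed.

(* By Cayley-Hamilton v is killed by the product of the T - c over the complex
   eigenvalues c; growth makes the factors with |c| < r injective on the
   complexification of E, so that they can be dropped from the product. *)
Lemma backward_growth_real S T (E : {vspace 'cV[R]_d}) (r : R) : (0 < d)%N ->
  S *m T = 1%:M -> 0 < r ->
  (forall v, v \in E -> T *m v \in E) ->
  (forall v K s, v \in E -> v != 0 -> 0 <= s < r ->
    exists n i, K * s ^+ n < `|iter n (mulmx T) v i ord0|) ->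
  forall v s, v \in E -> r^-1 < s ->
    exists K, forall n i, `|iter n (mulmx S) v i ord0| <= K * s ^+ n.
Proof.
move=> d0 ST r0 ET Egrow v s vE rs.
have s0 : 0 < s by apply: lt_trans rs; rewrite invr_gt0.
pose P (w : 'cV[C]_d) := reC w \in E /\ imC w \in E.
pose big (c : C) := r%:C <= `|c|.
have [l hl] := annihilating_roots T d0.
have toCv : reC (toC v) = v /\ imC (toC v) = 0.
  by split; apply/matrixP => i j; rewrite !mxE.
have Pv : P (toC v) by rewrite /P; case: toCv => -> ->; rewrite mem0v.
have Pst (c : C) (w : 'cV[C]_d) : P w -> P ((toC T - c%:M) *m w).
  move=> [w1 w2]; rewrite /P mulmxBl mul_scalar_mx !raddfB /= re_mulmx im_mulmx.
  have -> : reC (c *: w) = complex.Re c *: reC w - complex.Im c *: imC w.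
    apply/matrixP => i j; rewrite !mxE; case: c => a b; by case: (w i j).
  have -> : imC (c *: w) = complex.Re c *: imC w + complex.Im c *: reC w.
    apply/matrixP => i j; rewrite !mxE; case: c => a b; by case: (w i j).
  by split; rewrite !(rpredB, rpredD, rpredZ)//; exact: ET.
(* The real and imaginary parts of such an eigenvector lie in [E] and grow at most like |c|^n with
   |c| < r, so the growth hypothesis makes both vanish. *)
have Pinj (c : C) (w : 'cV[C]_d) : ~~ big c -> P w -> (toC T - c%:M) *m w = 0 -> w = 0.
  move=> cr [w1 w2]; rewrite mulmxBl mul_scalar_mx => /subr0_eq Tw.
  pose t := complex.Re `|c|.
  have tE : `|c| = t%:C by apply/esym/RRe_real/normr_real.
  have t01 : 0 <= t < r.
    by rewrite -lecR -tE normr_ge0/=; move: cr; rewrite /big tE lecR -ltNge.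
  have iterw n : iter n (mulmx (toC T)) w = c ^+ n *: w.
    elim: n => [|n ih]; first by rewrite expr0 scale1r.
    by rewrite iterS ih -scalemxAr Tw scalerA exprSr.
  pose K := complex.Re (\sum_i `|w i ord0|).
  have KE : K%:C = \sum_i `|w i ord0| by apply/RRe_real/ger0_real/sumr_ge0.
  have bnd n i : `|iter n (mulmx (toC T)) w i ord0| <= (K * t ^+ n)%:C.
    rewrite iterw mxE normrM normrX tE rmorphM rmorphXn mulrC ler_wpM2r//.
      by rewrite -rmorphXn lecR exprn_ge0//; case/andP: t01.
    by rewrite /= -/K KE (bigD1 i)//= lerDl sumr_ge0.
  have re0 : reC w = 0.
    apply: contrapT => /eqP a0; have [n [i ni]] := Egrow _ K t w1 a0 t01.
    rewrite (_ : iter n (mulmx T) (reC w) = reC (iter n (mulmx (toC T)) w)) in ni; last first.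
      by elim: n => //= n ->; rewrite re_mulmx.
    move: ni; rewrite ltNge => /negP; apply; rewrite -lecR; apply: le_trans (bnd n i).
    by rewrite mxE; exact: normc_ge_Re.
  have im0 : imC w = 0.
    apply: contrapT => /eqP a0; have [n [i ni]] := Egrow _ K t w2 a0 t01.
    rewrite (_ : iter n (mulmx T) (imC w) = imC (iter n (mulmx (toC T)) w)) in ni; last first.
      by elim: n => //= n ->; rewrite im_mulmx.
    move: ni; rewrite ltNge => /negP; apply; rewrite -lecR; apply: le_trans (bnd n i).
    by rewrite mxE normc_def lecR -sqrtr_sqr ler_wsqrtr// lerDr sqr_ge0.
  apply/matrixP => i j; have /matrixP/(_ i j) := re0; have /matrixP/(_ i j) := im0.
  by rewrite !mxE; case: (w i j) => x y /= -> ->.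
have hf := shift_prod_filter Pst Pinj Pv (hl (toC v)).
have STC : toC S *m toC T = 1%:M by rewrite -map_mxM ST map_mx1.
have [|c|K K0 hK] := @backward_growth _ _ _ _ _ s%:C (toC v) STC _ _ hf.
- by rewrite ltcR.
- rewrite mem_filter => /andP[bc _].
  have c0 : 0 < `|c| by apply: lt_le_trans bc; rewrite ltcR.
  split; first by rewrite -normr_gt0.
  apply: le_lt_trans (_ : (r%:C)^-1 < _); first by rewrite lef_pV2// posrE ltcR.
  by rewrite -fmorphV ltcR.
exists (complex.Re K) => n i.
have : `|iter n (mulmx (toC S)) (toC v) i ord0| <= K * s%:C ^+ n by exact: hK.
have -> : iter n (mulmx (toC S)) (toC v) = toC (iter n (mulmx S) v).
  by elim: n => //= n ->; rewrite map_mxM.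
rewrite mxE normc_def /= expr0n addr0 sqrtr_sqr -rmorphXn /=.
have -> : K = (complex.Re K)%:C by apply/esym/RRe_real/ger0_real.
by rewrite -rmorphM lecR.
Qed.

End RealSpectrum.

(** * Exponents and determinants along a periodic orbit *)

Section PeriodicOrbit.
Context {R : realType} {M : pointedMetricType R} {d : nat}.
Variables (f : M -> M) (A : M -> 'M[R]_d).

Lemma cocycleD n m x :
  cocycle f A (n + m) x = cocycle f A n (iter m f x) *m cocycle f A m x.
Proof.
elim: n => [|n ih]; first by rewrite mul1mx.
by rewrite addSn /= ih mulmxA iterD.
Qed.

Lemma det_cocycle n x :
  \det (cocycle f A n x) = \prod_(j < n) \det (A (iter j f x)).
Proof.
elim: n => [|n ih]; first by rewrite det1 big_ord0.
by rewrite /= det_mulmx ih big_ord_recr mulrC.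
Qed.

(** The almost-everywhere clause of [oseledets_splitting] at one point; for a periodic measure it
    holds along the whole orbit. *)
Definition splits_at l (lam : 'I_l -> \bar R) (m : 'I_l -> nat)
    (E : 'I_l -> M -> {vspace 'cV[R]_d}) x :=
  [/\ directv (\sum_i E i x)%VS /\ (\sum_i E i x = fullv)%VS,
      forall i, \dim (E i x) = m i,
      forall i, (linfun (mulmx (A x)) @: E i x <= E i (f x))%VS,
      forall i, lam i != -oo%E ->
        (linfun (mulmx (A x)) @: E i x = E i (f x))%VS
    & forall i v, v \in E i x -> v != 0 -> has_exponent f A x v (lam i)].

(** With finite exponents [A x] maps each subspace onto its successor, hence is surjective. *)
Lemma splits_at_unit l lam m E x : @splits_at l lam m E x ->
  (\sum_i E i (f x) = fullv)%VS -> (forall i, lam i != -oo%E) -> A x \in unitmx.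
Proof.
move=> [[_ sE] _ _ img _] sEf lamfin.
rewrite unitmxE unitfE; apply/negP => /det0P[u u0 uA].
have im : (linfun (mulmx (A x)) @: fullv)%VS = fullv :> {vspace 'cV[R]_d}.
  rewrite -[in LHS]sE limg_sum -[RHS]sEf; apply: eq_bigr => i _; exact: img.
case/negP: u0; apply/eqP/matrixP => i j; rewrite (ord1 i) [RHS]mxE.
have : (delta_mx j ord0 : 'cV[R]_d) \in (linfun (mulmx (A x)) @: fullv)%VS by rewrite im memvf.
move=> /memv_imgP[w _]; rewrite lfunE /= => wE.
have : u *m delta_mx j ord0 = 0 :> 'M[R]_(1, 1) by rewrite wE mulmxA uA mul0mx.
by move=> /matrixP/(_ ord0 ord0); rewrite -colE !mxE.
Qed.

Implicit Types (v : 'cV[R]_d).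
Variables (p : M) (N : nat).
Hypotheses (N0 : (0 < N)%N) (pN : iter N f p = p).

Lemma cocycle_periodic k v :
  cocycle f A (k * N) p *m v = iter k (mulmx (cocycle f A N p)) v.
Proof.
have itk k' : iter (k' * N) f p = p.
  by elim: k' => [|k' ih]; rewrite ?mul0n// mulSn iterD ih.
elim: k => [|k ih]; first by rewrite mul0n mul1mx.
by rewrite mulSn cocycleD itk -mulmxA ih.
Qed.

Lemma periodic_growth v c K s : has_exponent f A p v c%:E ->
  0 <= s < expR (N%:R * c) ->
  exists n i, K * s ^+ n < `|iter n (mulmx (cocycle f A N p)) v i ord0|.
Proof.
move=> hv /andP[s0 sr]; apply: contrapT => noex.
have bnd n i : `|iter n (mulmx (cocycle f A N p)) v i ord0| <= K * s ^+ n.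
  by rewrite leNgt; apply/negP => h; apply: noex; exists n, i.
(* Since s may be 0, a positive rate still below exp(N c) replaces it before logarithms are
   taken. *)
pose s1 := Num.max s (expR (N%:R * c) / 2).
have e0 := expR_gt0 (N%:R * c).
have s10 : 0 < s1 by rewrite lt_max divr_gt0// orbT.
have s1r : s1 < expR (N%:R * c) by rewrite gt_max sr/=; lra.
have N0' : (0 : R) < N%:R by rewrite ltr0n.
pose e := (N%:R * c - ln s1) / (2 * N%:R).
have le0 : 0 < N%:R * c - ln s1.
  by rewrite subr_gt0 -[X in _ < X]expRK ltr_ln ?posrE.
have ep : 0 < e by rewrite divr_gt0// mulr_gt0.
have hN : N%:R * (c - e) - ln s1 = N%:R * e by rewrite /e; field; rewrite gt_eqF.
have [n0 _ hn0] := has_exponent_bounds hv ep.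
have [n1 _ hn1] := near_expR_ge (d%:R * `|K| + 1) (mulr_gt0 N0' ep).
pose n := maxn n0 n1.
have /andP[h _] := hn0 (n * N)%N (leq_trans (leq_maxl n0 n1) (leq_pmulr n N0)).
have h1 := hn1 n (leq_maxr n0 n1).
rewrite cocycle_periodic in h.
have h2 : expR (n%:R * (N%:R * e)) * s1 ^+ n <= d%:R * `|K| * s1 ^+ n.
  have -> : expR (n%:R * (N%:R * e)) * s1 ^+ n = expR ((n * N)%:R * (c - e)).
    have -> : s1 ^+ n = expR (n%:R * ln s1) by rewrite expRM_natl lnK.
    by rewrite -expRD -hN natrM; congr expR; ring.
  apply: le_trans h _; apply: le_trans (enorm_le_sum _) _.
  rewrite -mulrA mulr_natl -[X in _ *+ X]card_ord -sumr_const; apply: ler_sum => i _.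
  apply: le_trans (bnd n i) _; apply: le_trans (ler_wpM2r _ (ler_norm K)) _.
    by rewrite exprn_ge0.
  rewrite ler_wpM2l//; apply: lerXn2r; rewrite ?nnegrE ?(ltW s10)//.
  by rewrite le_max lexx.
rewrite ler_pM2r ?exprn_gt0// in h2; lra.
Qed.

(* The forward exponents bound the backward growth of the basis vectors, hence
   the determinant of the inverse iterates applied to the basis. *)
Lemma periodic_det_lower l (lam : 'I_l -> \bar R) m E (gamma : d.-tuple (\bar R))
    (c : 'I_d -> R) : (0 < d)%N ->
  (forall j, splits_at lam m E (iter j f p)) ->
  tval gamma = flatten [seq nseq (m i) (lam i) | i <- enum 'I_l] ->
  (forall i, lam i != -oo%E) -> (forall k, tnth gamma k = (c k)%:E) ->
  expR (N%:R * \sum_k c k) <= `|\det (cocycle f A N p)|.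
Proof.
move=> d0 hE gammaE lamfin cE.
have [[dE sE] dimE _ _ hexp] := hE 0%N.
have [b [Bu hb]] := adapted_basis dE sE dimE gammaE.
set T := cocycle f A N p; pose S := invmx T.
have AU j : A (iter j f p) \in unitmx.
  apply: splits_at_unit (hE j) _ lamfin.
  by have [[_]] := hE j.+1.
have T0 : 0 < `|\det T|.
  rewrite normr_gt0 /T det_cocycle; apply/prodf_neq0 => j _.
  by rewrite -unitfE -unitmxE.
have TU : T \in unitmx by rewrite unitmxE unitfE -normr_gt0.
have ET i v : v \in E i p -> T *m v \in E i p.
  have h n : v \in E i p -> cocycle f A n p *m v \in E i (iter n f p).
    move=> vE; elim: n => [|n ih]; first by rewrite mul1mx.
    rewrite /= -mulmxA; have [_ _ img _ _] := hE n.
    apply: (subvP (img i)); apply/memv_imgP; exists (cocycle f A n p *m v) => //.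
    by rewrite lfunE.
  by move=> vE; have := h N vE; rewrite pN.
have N0' : (0 : R) < N%:R by rewrite ltr0n.
have B0 : 0 < `|\det (\matrix_(i, j) b j i ord0)| by rewrite normr_gt0 -unitfE -unitmxE.
set B := \matrix_(i, j) _ in Bu B0.
rewrite -[leRHS]lnK ?posrE// ler_expR; apply/ler_addgt0Pr => e e0.
pose e' := e / (N%:R * d%:R).
have d0' : (0 : R) < d%:R by rewrite ltr0n.
have e'0 : 0 < e' by rewrite divr_gt0// mulr_gt0.
have exK k : exists Kk, forall n i,
    `|iter n (mulmx S) (b k) i ord0| <= Kk * expR (- (N%:R * (c k - e'))) ^+ n.
  have [i [bE b0 g]] := hb k.
  have r0 := expR_gt0 (N%:R * c k).
  have rs : (expR (N%:R * c k))^-1 < expR (- (N%:R * (c k - e'))).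
    by rewrite -expRN ltr_expR ltrN2 ltr_pM2l//; lra.
  apply: (backward_growth_real d0 (mulVmx TU) r0 (ET i) _ bE rs).
  move=> v K' s vE v0 sr; apply: periodic_growth sr.
  by rewrite -cE g; exact: hexp.
have [K hK] := choice exK.
have iterE n (w : 'cV[R]_d) : iter n (mulmx S) w = iter n (mulmx S) 1%:M *m w.
  by elim: n => [|n ih]; rewrite /= ?mul1mx// ih mulmxA.
have detS n : `|\det (iter n (mulmx S) 1%:M)| = `|\det T| ^- n.
  elim: n => [|n ih]; first by rewrite /= det1 normr1 expr0 invr1.
  by rewrite iterS det_mulmx normrM ih det_inv normfV exprS invfM.
have key n : expR (n%:R * (N%:R * (\sum_k c k - d%:R * e') - ln `|\det T|)) <=
    d`!%:R * (\prod_k K k) / `|\det B|.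
  have : `|\det (iter n (mulmx S) 1%:M) * \det B| <=
      d`!%:R * \prod_k (K k * expR (- (N%:R * (c k - e'))) ^+ n).
    rewrite -det_mulmx; apply: norm_det_le => i j.
    have := hK j n i; rewrite iterE; congr (is_true (`|_| <= _)).
    by rewrite !mxE; apply: eq_bigr => k _; rewrite mxE.
  rewrite normrM detS big_split /= prodrXl.
  have -> : \prod_k expR (- (N%:R * (c k - e'))) =
      expR (- (N%:R * (\sum_k c k - d%:R * e'))).
    rewrite -expR_sum sumrN -mulr_sumr sumrB sumr_const card_ord.
    by rewrite [d%:R * _]mulr_natl.
  move=> h; rewrite ler_pdivlMr// mulrBr expRD.
  have -> : expR (- (n%:R * ln `|\det T|)) = `|\det T| ^- n.
    by rewrite expRN expRM_natl lnK.
  rewrite -mulrA; apply: le_trans (ler_wpM2l (expR_ge0 _) h) _.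
  rewrite mulrCA [X in _ * X]mulrCA mulrA -expRM_natl -expRD mulrN addrN expR0.
  by rewrite mulr1.
(* The right side of [key] is independent of n, so the exponent on its left cannot be positive. *)
have hle : N%:R * (\sum_k c k - d%:R * e') - ln `|\det T| <= 0.
  rewrite leNgt; apply/negP => del.
  have [n _ /(_ n (leqnn n))] := near_expR_ge (d`!%:R * (\prod_k K k) / `|\det B| + 1) del.
  by have := key n; lra.
have : e = N%:R * (d%:R * e') by rewrite /e'; field; rewrite !gt_eqF.
by lra.
Qed.

End PeriodicOrbit.

(** * Periodic measures *)

Section PeriodicMeasure.
Context {R : realType} {M : pointedMetricType R}.
Variables (f : M -> M) (p : M) (N : nat).
Hypotheses (N0 : (0 < N)%N) (pN : iter N f p = p).

Let NV0 : 0 <= (N%:R^-1 : R). Proof. by rewrite invr_ge0. Qed.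

(** N is any period, possibly not the least one: a point of the orbit is then counted several
    times. *)
Definition periodic_measure : set (borel M) -> \bar R :=
  mscale (NngNum NV0) (msum (fun j => (\d_(iter j f p : borel M))%R) N).

HB.instance Definition _ := Measure.on periodic_measure.

Lemma periodic_measureE B :
  periodic_measure B = (N%:R^-1 * \sum_(j < N) (iter j f p \in B)%:R)%:E.
Proof.
by rewrite /periodic_measure /mscale /msum /= EFinM -sumEFin.
Qed.

Let periodic_measure_setT : periodic_measure setT = 1%E.
Proof.
rewrite periodic_measureE; under eq_bigr do rewrite in_setT.
by rewrite sumr_const card_ord -[_ *+ _]mulr_natl mulr1 mulVf// pnatr_eq0 -lt0n.
Qed.

HB.instance Definition _ :=
  Measure_isProbability.Build _ _ _ periodic_measure periodic_measure_setT.

Definition periodic_probability : probability (borel M) R := periodic_measure.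

Lemma orbit_sum_shift (h : M -> R) :
  \sum_(j < N) h (iter j.+1 f p) = \sum_(j < N) h (iter j f p).
Proof.
case: N N0 pN => // n _ pn; rewrite big_ord_recr [RHS]big_ord_recl [RHS]addrC.
by congr (_ + _); congr h; exact: pn.
Qed.

Let mem_preimage (B : set M) x : (x \in f @^-1` B) = (f x \in B).
Proof. by apply/idP/idP; rewrite !inE. Qed.

Lemma periodic_ergodic : ergodic_measure f periodic_probability.
Proof.
split.
  move=> B mB; rewrite /= !periodic_measureE; congr (_ * _)%:E.
  rewrite -(orbit_sum_shift (fun x => (x \in B)%:R)).
  by apply: eq_bigr => j _; rewrite mem_preimage.
move=> B mB fB.
have BE j : (iter j f p \in B) = (p \in B).
  by elim: j => //= j <-; rewrite -[in RHS]fB mem_preimage.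
rewrite /= periodic_measureE; under eq_bigr do rewrite BE.
rewrite sumr_const card_ord -[_%:R *+ N]mulr_natl mulrA mulVf ?mul1r; last first.
  by rewrite pnatr_eq0 -lt0n N0.
by case: (_ \in _); [right|left].
Qed.

(** Every orbit point is an atom, so a null set misses the orbit. *)
Lemma periodic_ae (P : M -> Prop) :
  {ae periodic_probability, forall x, P x} -> forall j, P (iter j f p).
Proof.
move=> [B [mB B0 PB]] j; apply: contrapT => nP.
have iterM k : iter (k * N) f p = p.
  by elim: k => [|k ih]; rewrite ?mul0n// mulSn iterD ih pN.
have jE : iter j f p = iter (j %% N) f p.
  by rewrite {1}(divn_eq j N) addnC iterD iterM.
have jB : iter (j %% N) f p \in B by rewrite inE -jE; exact: PB.
move: B0; rewrite /= periodic_measureE => /eqP; rewrite eqe mulf_eq0.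
rewrite invr_eq0 pnatr_eq0 (negbTE (lt0n_neq0 N0)) /=.
rewrite psumr_eq0// => /allP/(_ (Ordinal (ltn_pmod j N0))).
by rewrite mem_index_enum /= jB oner_eq0 => /(_ isT).
Qed.

Lemma periodic_functional : continuous f ->
  invariant_functional f (fun phi => N%:R^-1 * \sum_(j < N) phi (iter j f p)).
Proof.
move=> cf; split; [split|].
- by move=> phi psi _ _; rewrite big_split mulrDr.
- by move=> c phi _; rewrite -mulr_sumr mulrCA.
- by move=> phi _ h; rewrite mulr_ge0 ?invr_ge0// sumr_ge0.
- by rewrite sumr_const card_ord -[_ *+ _]mulr_natl mulr1 mulVf// pnatr_eq0 -lt0n.
- by move=> phi _; congr (_ * _); exact: (orbit_sum_shift phi).
Qed.

End PeriodicMeasure.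

Section EventualMean.
Context {R : realType} {M : pointedMetricType R}.
Hypothesis cM : compact [set: M].

(** The sets where F n >= c for all n >= m increase to full measure, and Markov's inequality for
    [F m] bounds c times the measure of the m-th one by C. *)
Lemma eventual_mean_le (mu : probability (borel M) R) (F : nat -> M -> R) c C :
  (forall n, continuous (F n)) -> (forall n x, 0 <= F n x) -> 0 < c ->
  {ae mu, forall x, \forall n \near \oo, c <= F n x} ->
  (forall n, \int[mu]_x (F n x) <= C) -> c <= C.
Proof.
move=> cF F0 c0 aeF FC; rewrite leNgt; apply/negP => Cc.
pose G (m : nat) : set (borel M) :=
  \bigcap_(n in [set n | (m <= n)%N]) [set x | c <= F n x].
have mG m : measurable (G m).
  apply: bigcap_measurableType => n _.
  have -> : [set x | c <= F n x] = ~` [set x | - c < - F n x].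
    by apply/seteqP; split => x /=; rewrite ltrN2 leNgt => /negP.
  apply: measurableC; apply: open_borel; apply: open_lt_continuous.
  exact: continuous_opp.
have mGU : measurable (\bigcup_m G m) by exact: bigcup_measurable.
have GU : mu (\bigcup_m G m) = 1%E.
  have C0 : mu (~` \bigcup_m G m) = 0%E.
    have [B [mB B0 hB]] := aeF.
    apply/eqP; rewrite eq_le measure_ge0 andbT -B0.
    apply: le_measure; rewrite ?inE//; exact: measurableC.
  have := probability_setC mu mGU; rewrite C0 => /esym/eqP.
  have fin : mu (\bigcup_m G m) \is a fin_num.
    by rewrite ge0_fin_numE// (le_lt_trans (probability_le1 _ _)) ?ltry.
  by rewrite -(fineK fin) -EFinB eqe subr_eq0 => /eqP <-.
have Gm : {homo G : n m / (n <= m)%N >-> (n <= m)%O}.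
  move=> n m nm; apply/subsetPset => x Gx k /= mk; apply: Gx => /=.
  exact: leq_trans mk.
have /fine_cvgP[_ /cvgrPdist_lt cv] : (mu \o G) @ \oo --> 1%E.
  by rewrite -GU; exact: nondecreasing_cvg_mu.
have C0 : 0 <= C.
  by apply: le_trans (FC 0%N); apply: Rintegral_ge0 => x _; exact: F0.
have e0 : 0 < 1 - C / c by rewrite subr_gt0 ltr_pdivrMr// mul1r.
have [m _ /(_ m (leqnn m))] := cv _ e0; rewrite /= ltr_norml => /andP[_].
have : c * fine (mu (G m)) <= C.
  apply: le_trans (FC m); rewrite -Rintegral_indicT// -RintegralZl//; last first.
    exact: indic_integrable.
  apply: le_Rintegral => //.
  - have := integrableZl (measurableT : measurable (setT : set (borel M))) c (indic_integrable mu (mG m)).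
    by apply: eq_integrable => // x _.
  - exact: continuous_integrable.
  - move=> x _; rewrite indicE; have [/set_mem Gx|_] := boolP (x \in G m).
      by rewrite mulr1; apply: Gx => /=.
    by rewrite mulr0.
by rewrite -ler_pdivlMl// mulrC; lra.
Qed.

End EventualMean.

(** * Singular Hölder cocycles *)

(** One term -oo would make the sum -oo, against the lower bound; and each [lam i] does occur in
    [gamma], as its multiplicity is positive. *)
Lemma finite_exponents (R : realType) d l (lam : 'I_l -> \bar R) (m : 'I_l -> nat)
    (gamma : d.-tuple (\bar R)) a b :
  (forall i, (lam i < +oo)%E /\ (0 < m i)%N) ->
  tval gamma = flatten [seq nseq (m i) (lam i) | i <- enum 'I_l] ->
  (a%:E <= \sum_(j < d) tnth gamma j <= b%:E)%E ->
  exists c : 'I_d -> R, [/\ forall k, tnth gamma k = (c k)%:E,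
    forall i, lam i != -oo%E & a <= \sum_k c k <= b].
Proof.
move=> lamm gammaE sumab.
have gammaP y : y \in tval gamma -> exists i, y = lam i.
  rewrite gammaE => /flattenP[s /mapP[i _ ->]]; rewrite mem_nseq => /andP[_ /eqP ->].
  by exists i.
have fin k : tnth gamma k \is a fin_num.
  rewrite fin_numE; apply/andP; split; last first.
    have [i ->] := gammaP _ (mem_tnth k gamma).
    by have [/lt_eqF/negbT] := lamm i.
  apply/eqP => gk; move: sumab.
  have -> : \sum_(j < d) tnth gamma j = -oo%E.
    by apply/eqP; rewrite esum_eqNy; apply/existsP; exists k; rewrite gk eqxx.
  by rewrite leeNy_eq.
exists (fun k => fine (tnth gamma k)).
have gE k : tnth gamma k = (fine (tnth gamma k))%:E by rewrite fineK.
split => // [i|].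
  have : lam i \in tval gamma.
    rewrite gammaE; apply/flattenP; exists (nseq (m i) (lam i)).
      by apply/mapP; exists i => //; rewrite mem_enum.
    by rewrite mem_nseq eqxx andbT; have [] := lamm i.
  by move=> /tnthP[k ->]; have := fin k; rewrite fin_numE => /andP[].
by move: sumab; under eq_bigr do rewrite gE; rewrite sumEFin !lee_fin.
Qed.

Section SingularCocycle.
Context {R : realType} {M : pointedMetricType R} {d : nat}.
Hypothesis cM : compact [set: M].
Variables (f : M -> M) (A : M -> 'M[R]_d) (alpha : R).
Hypotheses (alpha_gt0 : 0 < alpha) (A_holder : holder_matrix A alpha).

(** The determinant is Lipschitz on bounded sets of matrices, and the entries of A are bounded by
    the Hölder condition from a base point on a space of finite diameter. *)
Lemma det_holder : exists2 C, 0 < C &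
  forall x y, `|\det (A x) - \det (A y)| <= C * mdist x y `^ alpha.
Proof.
have [C1 C10 hA] := A_holder.
pose x0 : M := point.
have cd : continuous (fun x : M => mdist x0 x).
  move=> x; apply/(@pseudometric_normed_Zmodule.cvgrPdist_lt _ R^o) => e e0.
  near=> y.
  have xy : mdist x y < e.
    by near: y; apply/nbhs_ballP; exists e => //; rewrite ballEmdist.
  have := metric_triangle x0 x y; have := metric_triangle x0 y x.
  rewrite (metric_sym y x) => h1 h2.
  by rewrite ltr_norml; apply/andP; split; lra.
have [D D0 hD] := compact_continuous_bounded cM cd.
pose K := 1 + \sum_i \sum_j `|A x0 i j| + C1 * D `^ alpha.
have S0 : 0 <= \sum_i \sum_j `|A x0 i j| by do 2 apply: sumr_ge0 => ? _.
have CD0 : 0 <= C1 * D `^ alpha by rewrite mulr_ge0 ?powR_ge0// ltW.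
have K1 : 1 <= K by rewrite /K; lra.
have AK x i j : `|A x i j| <= K.
  have h1 : `|A x0 i j - A x i j| <= C1 * D `^ alpha.
    have := entry_le_opnorm (A x0 - A x) i j; rewrite !mxE.
    move=> /le_trans; apply; apply: le_trans (hA _ _) _.
    rewrite ler_wpM2l ?(ltW C10)// ge0_ler_powR ?nnegrE ?mdist_ge0 ?(ltW D0) ?(ltW alpha_gt0)//.
    exact: le_trans (ler_norm _) (hD x).
  have h2 : `|A x0 i j| <= \sum_i \sum_j `|A x0 i j|.
    rewrite (bigD1 i)//= (bigD1 j)//= -addrA lerDl addr_ge0 ?sumr_ge0// => k _.
    exact: sumr_ge0.
  have : `|A x i j| <= `|A x0 i j| + `|A x0 i j - A x i j|.
    by rewrite distrC -{1}(subrK (A x0 i j) (A x i j)) addrC; exact: ler_normD.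
  rewrite /K; lra.
exists (d`!%:R * (d%:R * K ^+ d) * C1 + 1).
  by rewrite ltr_wpDl// !mulr_ge0// ?exprn_ge0// ?(ltW C10)//; lra.
move=> x y; have p0 := powR_ge0 (mdist x y) alpha.
have := @norm_detB_le _ _ (A x) (A y) K (C1 * mdist x y `^ alpha) K1 (AK x) (AK y) _.
move=> /(_ _)/le_trans -> //; last first.
  by rewrite mulrDl mul1r !mulrA lerDl.
move=> i j; have := entry_le_opnorm (A x - A y) i j; rewrite !mxE.
by move=> /le_trans; apply; exact: hA.
Unshelve. all: by end_near. Qed.

Lemma det_continuous : continuous (fun x => \det (A x)).
Proof.
have [C C0 h] := det_holder => x.
apply/(@pseudometric_normed_Zmodule.cvgrPdist_lt _ R^o) => e e0.
have r0 : 0 < (e / C) `^ alpha^-1 by rewrite powR_gt0// divr_gt0.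
near=> y.
have xy : mdist x y < (e / C) `^ alpha^-1.
  by near: y; apply/nbhs_ballP; exists ((e / C) `^ alpha^-1) => //; rewrite ballEmdist.
apply: le_lt_trans (h x y) _; rewrite -ltr_pdivlMl// mulrC.
have -> : e / C = ((e / C) `^ alpha^-1) `^ alpha.
  by rewrite -powRrM mulVf ?gt_eqF// powRr1// ltW// divr_gt0.
by rewrite gt0_ltr_powR ?nnegrE ?mdist_ge0// ltW.
Unshelve. all: by end_near. Qed.

(** Truncating inside the logarithm keeps its argument positive, so the result is continuous even
    where the determinant vanishes. *)
Definition trunc_logdet (L : nat) (x : M) : R :=
  ln (Num.max `|\det (A x)| (expR (- L%:R))).

Let max_gt0 L x : 0 < Num.max `|\det (A x)| (expR (- L%:R)).
Proof. by rewrite lt_max expR_gt0 orbT. Qed.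

Lemma trunc_logdet_continuous L : continuous (trunc_logdet L).
Proof.
have cm : continuous (fun x => Num.max `|\det (A x)| (expR (- L%:R))).
  apply: continuous_maxf; last exact: continuous_cst.
  by move=> x; apply: cvg_norm; exact: det_continuous.
move=> x; apply: (continuous_comp (cm x)).
by apply: continuous_ln; exact: max_gt0.
Qed.

Lemma trunc_logdet_mono L L' x : (L <= L')%N ->
  trunc_logdet L' x <= trunc_logdet L x.
Proof.
move=> LL'; rewrite ler_ln ?posrE ?max_gt0// ge_max !le_max lexx /=.
by rewrite ler_expR lerN2 ler_nat LL' orbT.
Qed.

Lemma trunc_logdet_ge L x : - L%:R <= trunc_logdet L x.
Proof. by rewrite -[leLHS]expRK ler_ln ?posrE ?expR_gt0// le_max lexx orbT. Qed.

Lemma trunc_logdet_ge_ln L x : 0 < `|\det (A x)| ->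
  ln `|\det (A x)| <= trunc_logdet L x.
Proof. by move=> h; rewrite ler_ln ?posrE// le_max lexx. Qed.

Lemma trunc_logdet_ub : exists2 K, 0 < K & forall L x, trunc_logdet L x <= K.
Proof.
have [K K0 hK] := compact_continuous_bounded cM det_continuous.
exists (K + 1) => [|L x]; first by rewrite addr_gt0.
rewrite -[leRHS]expRK ler_ln ?posrE ?expR_gt0// ge_max; apply/andP; split.
  by apply: le_trans (hK x) _; have := expR_ge1Dx (K + 1); lra.
by rewrite ler_expR; have : (0 : R) <= L%:R by []; lra.
Qed.

(* The truncation level n ^ 2 makes a single truncated term outweigh all the
   others in the sum of n terms. *)
Lemma trunc_logdet_sum (r K : R) n x : 0 <= r -> 0 < K ->
  (forall L x, trunc_logdet L x <= K) -> (0 < n)%N -> K <= n%:R ->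
  `|\det (cocycle f A n x)| <= expR (n%:R * r) ->
  \sum_(j < n) trunc_logdet (n ^ 2) (iter j f x) <= n%:R * r.
Proof.
move=> r0 K0 gK n0 Kn hdet.
have [/forallP big|] := boolP [forall j : 'I_n, expR (- (n ^ 2)%:R) < `|\det (A (iter j f x))|].
  have E (j : 'I_n) : trunc_logdet (n ^ 2) (iter j f x) = ln `|\det (A (iter j f x))|.
    by rewrite /trunc_logdet max_l// ltW// big.
  under eq_bigr do rewrite E.
  have pos (j : 'I_n) : 0 < `|\det (A (iter j f x))|.
    by apply: lt_trans (big j); exact: expR_gt0.
  rewrite -ler_expR expR_sum.
  under eq_bigr do rewrite lnK ?posrE ?pos//.
  by rewrite -normr_prod -det_cocycle.
(* This term is -n^2 <= -n K and the others add up to at most n K, so the sum is at most 0; here r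
   >= 0 is used. *)
move=> /forallPn[j]; rewrite -leNgt => hj.
rewrite (bigD1 j)//= /trunc_logdet max_r// expRK.
have : \sum_(i < n | i != j) trunc_logdet (n ^ 2) (iter i f x) <= n%:R * K.
  apply: le_trans (_ : _ <= \sum_(i < n) K) _; last first.
    by rewrite sumr_const card_ord [leRHS]mulr_natl.
  rewrite [leRHS](bigD1 j)//= -[leLHS]add0r; apply: lerD; first exact: ltW.
  by apply: ler_sum => i _; exact: gK.
have : n%:R * K <= (n ^ 2)%:R by rewrite natrX expr2 ler_wpM2l.
have : 0 <= n%:R * r by rewrite mulr_ge0.
rewrite /trunc_logdet; lra.
Qed.

End SingularCocycle.

Section LyapunovSum.
Context {R : realType} {M : pointedMetricType R} {d : nat}.
Variables (f : M -> M) (A : M -> 'M[R]_d).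

Lemma ergodic_det_upper (mu : probability (borel M) R) (gamma : d.-tuple (\bar R))
    (a r e : R) : lyapunov_exponents f A mu gamma -> 0 < e ->
  (a%:E <= \sum_(j < d) tnth gamma j <= r%:E)%E ->
  {ae mu, forall x, \forall n \near \oo,
    `|\det (cocycle f A n x)| <= expR (n%:R * (r + e))}.
Proof.
move=> [l [lam [m [E [[lamm _ _ aeE] gammaE]]]]] e0 sumab.
have [c [cE lamfin /andP[_ cr]]] := finite_exponents lamm gammaE sumab.
have [B [mB B0 hB]] := aeE.
exists B; split => // x /= nx; apply: hB => /= -[[dE sE] dimE _ _ hexp]; apply: nx.
have [b [Bu hb]] := adapted_basis dE sE dimE gammaE.
have hexp' k : has_exponent f A x (b k) (c k)%:E.
  by have [i [bE b0 g]] := hb k; rewrite -cE g; exact: hexp.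
apply: filterS (det_cocycle_upper Bu hexp' e0) => n /le_trans; apply.
by rewrite ler_expR ler_wpM2l// lerD2r.
Qed.

Lemma periodic_det_ge (p : M) N (gamma : d.-tuple (\bar R)) (a r : R)
    (N0 : (0 < N)%N) : iter N f p = p -> (0 < d)%N ->
  lyapunov_exponents f A (periodic_probability f p N0) gamma ->
  (a%:E <= \sum_(j < d) tnth gamma j <= r%:E)%E ->
  expR (N%:R * a) <= \prod_(j < N) `|\det (A (iter j f p))|.
Proof.
move=> pN d0 [l [lam [m [E [[lamm _ _ aeE] gammaE]]]]] sumab.
have [c [cE lamfin /andP[ac _]]] := finite_exponents lamm gammaE sumab.
have hE := periodic_ae pN aeE.
rewrite -normr_prod -det_cocycle.
apply: le_trans (periodic_det_lower N0 pN d0 hE gammaE lamfin cE).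
by rewrite ler_expR ler_wpM2l.
Qed.

End LyapunovSum.

Theorem theorem2p1 (R : realType) (M : pointedMetricType R)
    (M_compact : compact [set: M])
    (f : M -> M) (f_homeo : homeomorphism f)
    (theta : R) (theta_gt0 : 0 < theta)
    (f_spec : periodic_exp_specification f theta)
    (d : nat) (d_gt0 : (0 < d)%N)
    (alpha : R) (alpha_gt0 : 0 < alpha)
    (A : M -> 'M[R]_d) (A_holder : holder_matrix A alpha)
    (rho tau : R) (rho_gt0 : 0 < rho) (tau_gt0 : 0 < tau)
    (rho_tau : rho + tau < alpha * theta / 2)
    (A_sum : forall mu : probability (borel M) R, ergodic_measure f mu ->
      exists2 gamma : d.-tuple (\bar R), lyapunov_exponents f A mu gamma &
        ((- tau)%:E <= \sum_(j < d) tnth gamma j <= rho%:E)%E) :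
  forall x : M, A x \in unitmx.
Proof.
move=> x0; rewrite unitmxE unitfE; apply/negP => /eqP detx0.
have [cf [g [cg fg gf]]] := f_homeo.
have [C C0 hC] := det_holder M_compact alpha_gt0 A_holder.
have [K K0 hK] := trunc_logdet_ub M_compact alpha_gt0 A_holder.
(* The midpoint between the bound rho and the average forced by the periodic orbits. *)
pose b := (rho + (alpha * theta / 2 - tau)) / 2.
have rb : rho < b by rewrite /b; lra.
have [||mu muerg mub] := @exists_ergodic_measure _ _ M_compact f f_homeo
    (trunc_logdet A) b (trunc_logdet_continuous M_compact alpha_gt0 A_holder) _ _.
- by move=> m n x; exact: trunc_logdet_mono.
- move=> L; have [S S0 hS] := f_spec 1 ltr01.
  have gap0 : 0 < alpha * theta - 2 * tau - 2 * b by rewrite /b; lra.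
  (* With N = 2 k + S, the target -L - N tau - ln C + alpha theta k >= N b says that k times the gap
     is at least [const]. *)
  pose const := (tau + b) * S%:R + ln C + L%:R.
  have [k0 hk0] : exists k, const / (alpha * theta - 2 * tau - 2 * b) < k%:R.
    exists (Num.bound `|const / (alpha * theta - 2 * tau - 2 * b)|).
    by apply: le_lt_trans (ler_norm _) _; apply: archi_boundP.
  pose k := k0.+1; pose n := (2 * k)%N; pose N := (n + S)%N.
  have n0 : (0 < n)%N by rewrite /n muln_gt0.
  have N0 : (0 < N)%N by rewrite addn_gt0 n0.
  (* Starting k steps before [x0] puts it in the middle of the segment, where the shadowing is
     sharpest. *)
  have [p pN hp] := hS (iter k g x0) n n0.
  have kn : (k <= n)%N by rewrite /n leq_pmull.
  have iterK j x : iter j f (iter j g x) = x.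
    by elim: j x => // j ih x; rewrite iterSr [iter j.+1 g x]iterS gf ih.
  have := hp k kn; rewrite iterK.
  have -> : minn k (n - k) = k by rewrite /n mul2n -addnn addnK minnn.
  rewrite mul1r => hdist.
  have Dk : `|\det (A (iter k f p))| <= C * expR (- (alpha * theta * k%:R)).
    have := hC (iter k f p) x0; rewrite detx0 subr0 => /le_trans; apply.
    rewrite ler_wpM2l ?(ltW C0)//.
    apply: le_trans (_ : _ <= expR (- theta * k%:R) `^ alpha) _.
      by rewrite ge0_ler_powR ?nnegrE ?mdist_ge0 ?expR_ge0// ltW.
    rewrite /powR gt_eqF ?expR_gt0// expRK ler_expR le_eqVlt; apply/orP; left.
    by apply/eqP; ring.
  have [gamma hgamma sumg] := A_sum _ (periodic_ergodic N0 pN).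
  have hprod := periodic_det_ge pN d_gt0 hgamma sumg.
  (* The positive lower bound on the product excludes zero factors, so logarithms may be taken
     termwise. *)
  have pos j : (j < N)%N -> 0 < `|\det (A (iter j f p))|.
    move=> jN; rewrite lt0r normr_ge0 andbT; apply/negP => /eqP h0.
    move: hprod; rewrite (bigD1 (Ordinal jN))//= h0 mul0r leNgt expR_gt0.
    by [].
  have kN : (k < N)%N.
    by rewrite /N /n mul2n -addnn -addnA -[ltnLHS]addn0 ltn_add2l addn_gt0.
  exists (fun phi => N%:R^-1 * \sum_(j < N) phi (iter j f p)).
    exact: periodic_functional.
  have NR : (0 : R) < N%:R by rewrite ltr0n.
  rewrite mulrC ler_pdivlMr//.
  have h1 : N%:R * - tau <= \sum_(j < N) ln `|\det (A (iter j f p))|.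
    rewrite -ler_expR expR_sum; apply: le_trans hprod _.
    by apply: ler_prod => j _; rewrite normr_ge0 lnK ?lexx// posrE pos.
  rewrite (bigD1 (Ordinal kN))//= in h1; rewrite (bigD1 (Ordinal kN))//=.
  (* Truncation replaces this very negative term by one that is at least -L and lowers no other
     term, so the sum rises by almost alpha theta k. *)
  have h2 : ln `|\det (A (iter k f p))| <= ln C - alpha * theta * k%:R.
    apply: le_trans (_ : ln (C * expR (- (alpha * theta * k%:R))) <= _).
      by rewrite ler_ln ?posrE ?pos// mulr_gt0// expR_gt0.
    by rewrite lnM ?posrE ?expR_gt0// expRK.
  have h3 := trunc_logdet_ge A L (iter k f p).
  have h4 : \sum_(i < N | i != Ordinal kN) ln `|\det (A (iter i f p))| <=
      \sum_(i < N | i != Ordinal kN) trunc_logdet A L (iter i f p).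
    by apply: ler_sum => i _; apply: trunc_logdet_ge_ln; exact: pos.
  have h5 : const < k%:R * (alpha * theta - 2 * tau - 2 * b).
    rewrite -ltr_pdivrMr//; apply: lt_le_trans hk0 _.
    by rewrite ler_nat.
  have NE : N%:R = 2 * k%:R + S%:R :> R by rewrite /N /n natrD natrM.
  rewrite NE in h1 *; rewrite /const in h5; nra.
have [gamma hgamma sumg] := A_sum _ muerg.
pose e := (b - rho) / 2.
have e0 : 0 < e by rewrite /e; lra.
have ae := ergodic_det_upper hgamma e0 sumg.
(* K' >= K makes [F] below nonnegative, and K' - rho - e = K is a positive threshold. *)
pose K' := K + rho + e.
have K'0 : 0 < K' by rewrite /K'; lra.
have cgL L := trunc_logdet_continuous M_compact alpha_gt0 A_holder L.
have citer j L : continuous (fun x => trunc_logdet A L (iter j f x)).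
  elim: j => [|j ih]; first exact: cgL.
  have -> : (fun x => trunc_logdet A L (iter j.+1 f x)) =
      (fun x => trunc_logdet A L (iter j f x)) \o f.
    by apply/funext => x; rewrite iterSr.
  exact: continuous_compf.
have [inv _] := muerg.
have Iiter j L : \int[mu]_x (trunc_logdet A L (iter j f x)) =
    \int[mu]_x (trunc_logdet A L x).
  elim: j => [//|j ih]; rewrite -ih.
  rewrite -(Rintegral_invariant M_compact cf inv measurableT (preimage_setT f) (citer j L)).
  by apply: eq_Rintegral => x _; rewrite iterSr.
(* The level varies with the length of the average; this is allowed because [mub] holds at every
   level. The sign turns an eventual upper bound into a lower one. *)
pose F n x := K' - n.+1%:R^-1 * \sum_(j < n.+1) trunc_logdet A (n.+1 ^ 2) (iter j f x).
have posI := Rintegral_setT_positive M_compact mu.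
have csum n : continuous (fun x => \sum_(j < n.+1) trunc_logdet A (n.+1 ^ 2) (iter j f x)).
  by apply: (continuous_sum (h := fun j x => trunc_logdet A (n.+1 ^ 2) (iter j f x))).
have cF n : continuous (F n).
  apply: continuous_sub; first exact: continuous_cst.
  exact: continuous_scale.
have : K' - rho - e <= K' - b; last by rewrite /e; lra.
apply: (eventual_mean_le M_compact (mu := mu) cF).
- move=> n x; rewrite /F subr_ge0 ler_pdivrMl ?ltr0n//.
  apply: le_trans (_ : _ <= \sum_(j < n.+1) K') _.
    by apply: ler_sum => j _; apply: le_trans (hK _ _) _; rewrite /K'; lra.
  by rewrite sumr_const card_ord [leRHS]mulr_natl.
- by rewrite /K'; lra.
- have [B [mB B0 hB]] := ae.
  exists B; split => // x /= nx; apply: hB => /= hx; apply: nx.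
  move: hx => [n0 _ hn0].
  have [n1 hn1] : exists n1, K < n1%:R.
    by exists (Num.bound K); apply: archi_boundP; exact: ltW.
  exists (maxn n0 n1) => // n /=; rewrite geq_max => /andP[nn0 nn1].
  have := @trunc_logdet_sum _ _ _ f A (rho + e) K n.+1 x _ K0 hK isT _ (hn0 n.+1 (leqW nn0)).
  have Kn : K <= n.+1%:R.
    by apply: le_trans (ltW hn1) _; rewrite ler_nat leqW.
  have re0 : 0 <= rho + e by lra.
  move=> /(_ re0 Kn); rewrite -ler_pdivrMl ?ltr0n// /F => h; rewrite -addrA -opprD lerD2l lerN2; exact: h.
- move=> n; rewrite /F (functional_sub posI)//; [|exact: continuous_cst|exact: continuous_scale].
  rewrite (functional_cst posI) (functional_scale posI)//.
  rewrite (functional_sum posI (h := fun j x => trunc_logdet A (n.+1 ^ 2) (iter j f x)))//.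
  under eq_bigr do rewrite Iiter.
  rewrite sumr_const card_ord -[X in _ - _ * X]mulr_natl mulrA mulVf ?pnatr_eq0// mul1r.
  by rewrite lerD2l lerN2.
Qed.
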